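(* Let $p$ be an odd prime, let $H,N$ be integers with $0\le H<H+N<p$, and let $\ell\ge 2r\ge1$ be fixed integers. For $a\in\mathbb{F}_p^*$ let $F_\ell(a,H,N)$ denote the number of solutions of $$\prod_{i=1}^{\ell}n_i!\equiv a\pmod p,\qquad H+1\le n_1,\dots,n_\ell\le H+N.$$ Then $$\max_{a\in\mathbb{F}_p^*}\left|F_\ell(a,H,N)-\frac{N^\ell}{p-1}\right|\ll N^{3\ell/4+r/2-1+2^{-r}}p^{(\ell-2r)/8}(\log p)^{(\ell-2r)/4}.$$
   Context: The implied constant may depend on $\ell$ and $r$ but not on $p,H,N,a$. *)

(* Defs.v *)
From HB Require Import structures.
From mathcomp Require Import all_boot all_order all_algebra.
From mathcomp Require Import all_classical all_reals all_analysis.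

Set Implicit Arguments.
Unset Strict Implicit.
Unset Printing Implicit Defensive.

Import Order.TTheory GRing.Theory Num.Theory.

Local Open Scope ring_scope.

(* F_ell(a, H, N). Drawing each n_i from 'I_(H + N).+1, i.e. from the naturals
   <= H + N, loses no solution, because of the bound n_i <= H + N. *)
Definition factorial_product_count (ell p H N : nat) (a : 'F_p) : nat :=
  #|[set n : {ffun 'I_ell -> 'I_(H + N).+1} |
      [forall i, (H + 1 <= n i <= H + N)%N]
      && (\prod_(i < ell) ((n i)`!)%:R == a)]|.

(* Main.v *)
(** The deviation of F_l(a,H,N) from its mean is, by orthogonality, an average
    over the nontrivial characters chi of F_p^* of S(chi)^l, where S(chi) is the
    sum of chi(n!) over the interval.  Bounding l - 2r factors by max |S(chi)|
    leaves the 2r-th moment, i.e. the number of solutions of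
    n_1!...n_r! = n_{r+1}!...n_{2r}!.

    That number J_r is estimated by induction: cut the interval into blocks of
    length K; for two factorials in one block, (t+k)!/t! is a polynomial in t of
    degree k, so each prescribed value is taken at most k times, whence
    J_{r+1} <= (N/K + 1)(N J_r + K^2 N^(2r)), and K = N^(2^-(r+1)) is optimal.

    For |S(chi)|, the identity chi((n+k)!) = chi(n!) chi((n+1)...(n+k)), averaged
    over k < K, and Cauchy-Schwarz lead to sums over an interval of
    chi((n+l+1)...(n+k)).  Weighting the interval by differences i - j makes the
    Fourier coefficients of the weight nonnegative, so the completed sums are
    controlled by Weil's bound without any logarithm.

    Weil's bound for chi(f(x)) psi(x), with f a product of distinct linear
    factors, is proved elementarily: the L-function is a polynomial, its reciprocal
    roots have power sums given by the character sums over F_{p^n}, and Stepanov's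
    method bounds the latter by O(p^(n/2)) for even n.  The trace in psi is
    removed by the substitution x = z^p - z + c. *)

Require Import Defs.
From HB Require Import structures.
From mathcomp Require Import all_boot all_order all_algebra.
From mathcomp Require Import all_fingroup all_solvable all_field.
From mathcomp Require Import all_classical all_reals all_analysis.
From mathcomp Require Import complex zify ring lra.

Set Implicit Arguments.
Unset Strict Implicit.
Unset Printing Implicit Defensive.

Import Order.TTheory GRing.Theory Num.Theory.
Import Normc.

Local Open Scope ring_scope.

(** * Stepanov's method *)

(** For Weil's bound only the growth in n of the sums over F_(p^n) matters: an estimate B p^(n/2)
    along even n, where B may depend on p and f in any way, forces |w|^2 <= p for each reciprocal
    root w, and the number of roots is the final constant. Hence the crude constants in Stepanov's
    method, and the freedom to multiply degrees by p in the substitution. The substitution is there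
    because Stepanov's method exploits one equation f(x)^e = u, with e the exponent of the norm, but
    no condition on the trace; z^p - z + c takes each value of the same trace as c exactly p times.
    Evenness makes p^n a square s^2, so that (p - 1) e = (s - 1)(s + 1), and s is the scale of the
    orders of vanishing. A simple root of f is what makes the auxiliary polynomial nonzero. The
    resulting estimates are |S(chi)| << N^(3/4) p^(1/8) for nontrivial chi, and J_r << N^(2r - 1 +
    2^(-r)). *)

Lemma nderivnM (R : comNzRingType) (P Q : {poly R}) n :
  (P * Q)^`N(n) = \sum_(i < n.+1) P^`N(i) * Q^`N(n - i).
Proof.
elim/poly_ind: P n => [|P c IH] n.
  rewrite mul0r linear0 big1 // => i _; by rewrite linear0 mul0r.
case: n => [|n].
  by rewrite big_ord_recl big_ord0 addr0 !nderivn0.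
have XE (S : {poly R}) : (S * 'X)^`N(n.+1) = S^`N(n) + S^`N(n.+1) * 'X.
  by rewrite -[S * 'X]addr0 -[X in _ + X]/(0%:P) nderivnMXaddC.
rewrite mulrDl mulrAC nderivnD XE mul_polyC nderivnZ -mul_polyC !IH.
rewrite [in RHS]big_ord_recl [in X in X * 'X]big_ord_recl !nderivn0 !subn0.
rewrite [X in _ = _ + X](eq_bigr (fun i : 'I_n.+1 => P^`N(i) * Q^`N(n - i)
  + P^`N(i.+1) * Q^`N(n - i) * 'X)) => [|i _]; last first.
  by rewrite lift0 nderivnMXaddC subSS; ring.
under [X in _ + (_ + X) * _ + _]eq_bigr => i _ do rewrite lift0 subSS.
by rewrite big_split /= -mulr_suml; ring.
Qed.

Lemma dvdp_exp_nderivnM (F : fieldType) (f g : {poly F}) n k :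
  f ^+ (n - k) %| (f ^+ n * g)^`N(k).
Proof.
elim: n k => [|n IH] k; first by rewrite sub0n expr0 dvd1p.
rewrite exprS -mulrA nderivnM; apply: (big_ind (fun S => _ %| S)) => [|p q|i _].
- exact: dvdp0.
- exact: dvdp_add.
case: (posnP i) => [->|i_gt0].
  rewrite nderivn0 subn0; apply: (@dvdp_trans _ (f ^+ (n - k).+1)).
    by apply: dvdp_exp2l; lia.
  by rewrite exprS dvdp_mul.
apply: dvdp_mull; apply: dvdp_trans (IH (k - i)%N); apply: dvdp_exp2l.
by have := ltn_ord i; lia.
Qed.

(** The Taylor expansion at x in Hasse derivatives involves no division by factorials, so orders of
    vanishing beyond the characteristic are detected, unlike with iterated derivatives. *)
Lemma dvdp_XsubC_exp_nderivn (F : fieldType) (P : {poly F}) x n :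
  (forall k, (k < n)%N -> root P^`N(k) x) -> ('X - x%:P) ^+ n %| P.
Proof.
move=> Pk; rewrite -[X in _ %| X]comp_polyXr /comp_poly.
rewrite -[X in _.[X]](subrKC x%:P) nderiv_taylor; last exact: mulrC.
apply: (big_ind (fun S => _ %| S)) => [|p q|i _]; [exact: dvdp0|exact: dvdp_add|].
rewrite nderivn_map horner_map /=.
have [/Pk/rootP->|le_ni] := ltnP i n; first by rewrite mul0r dvdp0.
exact/dvdp_mull/dvdp_exp2l.
Qed.

Lemma dvdp_prod_XsubC_exp (F : fieldType) (s : seq F) (n : F -> nat) P :
    uniq s -> (forall x, x \in s -> ('X - x%:P) ^+ n x %| P) ->
  \prod_(x <- s) ('X - x%:P) ^+ n x %| P.
Proof.
elim: s => [|x s IH] /=; first by rewrite big_nil dvd1p.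
case/andP=> xs us H; rewrite big_cons Gauss_dvdp.
  rewrite H ?mem_head //= IH // => y ys; apply: H; exact: mem_behead.
rewrite coprimep_expl // coprimep_sym coprimep_XsubC.
apply/rootP; rewrite horner_prod => /eqP; rewrite prodf_seq_eq0.
case/hasP=> y ys; rewrite /= horner_exp hornerXsubC expf_eq0 subr_eq0.
by case/andP=> _ /eqP e; rewrite e ys in xs.
Qed.

Lemma linear_system_nontrivial (F : fieldType) (I T : finType)
    (a : I -> T -> F) : (#|T| < #|I|)%N ->
  exists2 c : I -> F, (exists i, c i != 0) &
    forall t, \sum_i c i * a i t = 0.
Proof.
move=> ltTI; pose A := \matrix_(i < #|I|, t < #|T|) a (enum_val i) (enum_val t).
have /rowV0Pn[v vA vn0] : kermx A != 0.
  rewrite -mxrank_eq0 mxrank_ker -lt0n subn_gt0.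
  exact: leq_ltn_trans (rank_leq_col A) ltTI.
exists (fun i => v 0 (enum_rank i)).
  have /rV0Pn[i vi] := vn0; exists (enum_val i); by rewrite enum_valK.
move=> t; have /(congr1 (fun w : 'rV_#|T| => w 0 (enum_rank t))) :=
  sub_kermxP vA.
rewrite !mxE => E; rewrite -[RHS]E.
rewrite (reindex (@enum_val I predT)) /=; last first.
  by exists enum_rank => i _; rewrite ?enum_valK ?enum_rankK.
by apply: eq_bigr => i _; rewrite !mxE enum_valK !enum_rankK.
Qed.

(* The orders at the simple root b of g of the terms lie in the intervals
   [i e + q j, i e + q j + e), which are pairwise disjoint. *)
Lemma sparse_sum_neq0 (F : fieldType) (g g1 : {poly F}) (b : F) (d e J q : nat)
    (r : 'I_d * 'I_J -> {poly F}) :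
    g = ('X - b%:P) * g1 -> ~~ root g1 b -> (d * e <= q)%N ->
    (forall ij, size (r ij) <= e)%N -> (exists ij, r ij != 0) ->
  \sum_ij r ij * g ^+ (ij.1 * e) * ('X - b%:P) ^+ (q * ij.2) != 0.
Proof.
move=> gE g1b le_de_q size_r [ij0 rij0]; apply/eqP => sum0.
pose w (ij : 'I_d * 'I_J) := (ij.1 * e + q * ij.2)%N.
case: (@arg_minnP _ ij0 (fun ij => r ij != 0) w rij0) => {ij0 rij0} m rm minm.
have sep ij : r ij != 0 -> ij != m -> (w m + e <= w ij)%N.
  move=> rij ne; have := minm _ rij; rewrite /w.
  case: ij m ne {rm minm rij} => [i j] [k l] /=; rewrite xpair_eqE => ne.
  have le i' : (i' < d -> i' * e + e <= q)%N.
    by move=> lt; apply: leq_trans le_de_q; rewrite -mulSnr leq_mul2r lt orbT.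
  have [ltlj|ltjl|/val_inj ejl] := ltngtP l j.
  - have := le k (ltn_ord k); have : (q * l + q <= q * j)%N.
      by rewrite -mulnSr leq_mul2l ltlj orbT.
    lia.
  - have := le i (ltn_ord i); have : (q * j + q <= q * l)%N.
      by rewrite -mulnSr leq_mul2l ltjl orbT.
    case: (posnP e) => [->|]; lia.
  rewrite ejl eqxx andbT in ne *.
  have [ltki|ltik|/val_inj eik] := ltngtP k i; last by rewrite eik eqxx in ne.
    have : (k * e + e <= i * e)%N by rewrite -mulSnr leq_mul2r ltki orbT.
    lia.
  have : (i * e + e <= k * e)%N by rewrite -mulSnr leq_mul2r ltik orbT.
  lia.
have Xb0 : 'X - b%:P != 0 by rewrite polyXsubC_eq0.
(* Every other term is divisible by this power, hence so is the m-th one; after division by (X -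
   b)^(w m), the nonzero [r m], of size at most e, would be divisible by (X - b)^e. *)
have dv : ('X - b%:P) ^+ (w m + e) %|
    r m * g ^+ (m.1 * e) * ('X - b%:P) ^+ (q * m.2).
  move: sum0; rewrite (bigD1 m) //= => /eqP; rewrite addr_eq0 => /eqP->.
  rewrite dvdpNr; apply: (big_ind (fun S => _ %| S)) => [|p1 p2|ij ne].
  - exact: dvdp0.
  - exact: dvdp_add.
  have [->|/sep/(_ ne) le] := eqVneq (r ij) 0; first by rewrite !mul0r dvdp0.
  apply: (dvdp_trans (dvdp_exp2l _ le)); rewrite /w exprD dvdp_mul //.
  by apply: dvdp_mull; rewrite gE exprMn dvdp_mulr.
have : ('X - b%:P) ^+ e %| r m * g1 ^+ (m.1 * e).
  rewrite -(@dvdp_mul2r _ (('X - b%:P) ^+ w m)) ?expf_neq0 // -exprD addnC.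
  congr (_ %| _): dv; rewrite gE /w exprMn exprD; ring.
rewrite Gauss_dvdpl; last first.
  by rewrite coprimep_expl // coprimep_expr // coprimep_sym coprimep_XsubC.
move/(dvdp_leq rm); rewrite size_exp_XsubC => le.
by have := leq_ltn_trans (size_r m) le; rewrite ltnn.
Qed.

(** Since (X - b)^q = X^q - b^q for q = p^n, the powers (X - b)^(q j) act as constants for the Hasse
    derivatives of order below q. In [stepanov_bound] they therefore come out of the derivatives
    unchanged. *)
Lemma nderivn_pexpX (F : fieldType) p n k j (b : F) :
    p \in [pchar F] -> (0 < k < p ^ n)%N ->
  (('X - b%:P) ^+ (p ^ n * j))^`N(k) = 0.
Proof.
move=> pF; have pr := pcharf_prime pF; set q := (p ^ n)%N.
have XqE : ('X - b%:P) ^+ q = 'X^q - (b ^+ q)%:P.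
  have nat_q : [pchar {poly F}].-nat q.
    by rewrite pnatX pnatE // pchar_poly pF.
  by rewrite exprDn_pchar // exprNn_pchar // rmorphXn.
elim: j k => [|j IH] k /andP[k0 kq].
  by rewrite muln0 expr0 -[1]/(1%:P) nderivnC eqn0Ngt k0.
rewrite mulnS exprD nderivnM big1 // => i _.
have [i0|i0] := posnP i; last first.
  have lt_iq : (i < q)%N by rewrite (leq_ltn_trans _ kq) // -ltnS ltn_ord.
  rewrite XqE nderivnB nderivnC nderivnXn eqn0Ngt i0 subr0 -mulr_natr.
  suff pC : (p %| 'C(q, i))%N.
    move: pC; rewrite (@dvdn_pcharf {poly F} p) ?pchar_poly // => /eqP->.
    by rewrite mulr0 mul0r.
  (* Otherwise i C(q, i) = q C(q - 1, i - 1) would make q divide i, although 0 < i < q. *)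
  apply/negPn/negP; rewrite -prime_coprime // => /(coprimeXl n) /Gauss_dvdl dvdq.
  have : (q %| i * 'C(q, i))%N.
    by case: (nat_of_ord i) i0 => // i' _; rewrite -mul_bin_diag dvdn_mulr.
  by rewrite dvdq => /(dvdn_leq i0); rewrite leqNgt lt_iq.
by rewrite i0 subn0 IH ?k0 // mulr0.
Qed.

(** Deriving k times costs at most k factors g, so the degree of the quotient is governed by k m and
    not by n m. This keeps the linear conditions in [stepanov_bound] fewer than the unknowns. *)
Lemma hasse_quotient (F : fieldType) (g : {poly F}) (m n a k : nat)
    (H := (g ^+ n * 'X^a)^`N(k) %/ g ^+ (n - k)) :
    size g = m.+1 -> (k <= n)%N ->
  (g ^+ n * 'X^a)^`N(k) = g ^+ (n - k) * H /\ (size H <= a.+1 + k * m)%N.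
Proof.
move=> size_g le_kn; have g0 : g != 0 by rewrite -size_poly_gt0 size_g.
have HE : (g ^+ n * 'X^a)^`N(k) = H * g ^+ (n - k).
  by rewrite divpK // dvdp_exp_nderivnM.
split; first by rewrite HE mulrC.
have [->|H0] := eqVneq H 0; first by rewrite size_poly0.
have sz_exp i : size (g ^+ i) = (i * m).+1.
  by rewrite -(prednK (_ : 0 < size (g ^+ i))%N) ?size_poly_gt0 ?expf_neq0 //
    size_exp size_g mulnC.
have := congr1 (fun f : {poly F} => size f) HE.
rewrite size_mul ?expf_neq0 // sz_exp addnS /= => eqH.
have : (size ((g ^+ n * 'X^a)^`N(k))%R <= size (g ^+ n * 'X^a)%R - k)%N.
  exact: size_poly.
rewrite eqH size_mulXn ?expf_neq0 // sz_exp => le.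
have : (n * m = (n - k) * m + k * m)%N by rewrite -mulnDl subnK.
move: le; move: (n * m)%N ((n - k) * m)%N (k * m)%N (size H) => *; lia.
Qed.

(* Linear algebra provides coefficients for which
   g^M * sum_ij r_ij g^(ie) (X - b)^(qj) vanishes to order M at every point of X:
   there g^e = u and (X - b)^q = X - b^q, so that the k-th Hasse derivative
   reduces to a polynomial of degree about q/d + J + kM times a power of g. *)
Lemma stepanov_bound (F : fieldType) (p h d t m : nat) (g g1 : {poly F})
    (b u : F) (X : seq F) (s := (p ^ h)%N) (q := (p ^ (2 * h))%N) :
    p \in [pchar F] -> (0 < h)%N -> (d * t)%N = s.-1 ->
    size g = m.+1 -> g = ('X - b%:P) * g1 -> ~~ root g1 b -> uniq X ->
    (forall x, x \in X ->
      [/\ x ^+ q = x, g.[x] != 0 & g.[x] ^+ (t * s.+1) = u]) ->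
  (d * size X <= q + (6 * d * m + 2) * s)%N.
Proof.
move=> pF h_gt0 dt size_g gE g1b uX XP.
have p_gt1 := prime_gt1 (pcharf_prime pF).
have s_gt1 : (1 < s)%N by rewrite /s -{1}(expn0 p) ltn_exp2l.
have qE : q = (s * s)%N by rewrite /q mul2n -addnn expnD.
set e := (t * s.+1)%N in XP *.
(* M is the order of vanishing to be forced, D bounds the size of each polynomial that has to
   vanish, and J exceeds t = M / d by just enough for the unknowns to outnumber the equations. *)
set M := s.-1 in dt *; set J := (t + m.+1)%N; set D := (e + J + M * m)%N.
have sE : s = M.+1 by rewrite /M prednK // ltnW.
have deE : (d * e)%N = q.-1 by rewrite /e mulnA dt qE sE; lia.
have M_gt0 : (0 < M)%N by lia.
have [d_gt0 t_gt0] : (0 < d /\ 0 < t)%N.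
  by apply/andP; rewrite -muln_gt0 dt.
have g0 : g != 0 by rewrite -size_poly_gt0 size_g.
have m_gt0 : (0 < m)%N.
  rewrite -ltnS -size_g gE size_monicM ?monicXsubC ?size_XsubC //=.
    by rewrite ltnS size_poly_gt0; apply: contraNneq g1b => ->; rewrite root0.
  by apply: contraNneq g1b => ->; rewrite root0.
pose I := ('I_d * 'I_J * 'I_e)%type; pose T := ('I_M * 'I_D)%type.
have ltTI : (#|{: T}| < #|{: I}|)%N.
  rewrite !card_prod !card_ord.
  (* By d t = M and d e = q - 1 = M (s + 1), there are M (e + (m + 1)(s + 1)) unknowns against M (e
     + t + m + 1 + M m) equations. *)
  have -> : (d * J * e = (M + d * m.+1) * e)%N by rewrite mulnDr dt.
  have -> : ((M + d * m.+1) * e = M * e + m.+1 * (M * s.+1))%N.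
    by rewrite mulnDl mulnAC deE mulnC qE sE; lia.
  have -> : (M * e + m.+1 * (M * s.+1) = M * (e + m.+1 * s.+1))%N by lia.
  rewrite ltn_pmul2l // /D /J -addnA ltn_add2l sE.
  have : (t <= M)%N by rewrite -dt leq_pmull.
  lia.
pose H k (i : I) := (g ^+ (M + i.1.1 * e) * 'X^(i.2))^`N(k)
                    %/ g ^+ (M + i.1.1 * e - k).
pose a (i : I) (kt : T) :=
  (u ^+ i.1.1 *: H kt.1 i * ('X - (b ^+ q)%:P) ^+ i.1.2)`_kt.2.
have [c [i0 ci0] ca] := linear_system_nontrivial a ltTI.
have HP k (i : I) : (k < M)%N ->
    (g ^+ (M + i.1.1 * e) * 'X^(i.2))^`N(k) = g ^+ (M + i.1.1 * e - k) * H k i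
    /\ (size (H k i) <= e + M * m)%N.
  move=> ltkM; have le_k : (k <= M + i.1.1 * e)%N by lia.
  have [E le] := hasse_quotient i.2 size_g le_k; split; first exact: E.
  apply: leq_trans le _; rewrite leq_add ?ltn_ord //.
  by rewrite leq_mul2r (ltnW ltkM) orbT.
have W0 k : (k < M)%N -> \sum_i c i *:
    (u ^+ i.1.1 *: H k i * ('X - (b ^+ q)%:P) ^+ i.1.2) = 0.
  move=> ltkM; apply/polyP => l; rewrite coef0 coef_sum.
  have [ltlD|leDl] := ltnP l D.
    rewrite -[RHS](ca (Ordinal ltkM, Ordinal ltlD)).
    by apply: eq_bigr => i _; rewrite coefZ.
  apply: big1 => i _; rewrite nth_default //.
  apply: leq_trans leDl; apply: leq_trans (size_scale_leq _ _) _.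
  apply: leq_trans (size_polyMleq _ _) _.
  rewrite size_exp_XsubC addnS /=.
  apply: leq_trans (leq_add (size_scale_leq _ _) (leqnn _)) _.
  have [_ le] := HP k i ltkM.
  by rewrite /D addnAC leq_add // ltnW ?ltn_ord.
pose r (ij : 'I_d * 'I_J) := \sum_(l < e) c (ij, l) *: 'X^l.
pose Q := \sum_ij r ij * g ^+ (ij.1 * e) * ('X - b%:P) ^+ (q * ij.2).
have size_r ij : (size (r ij) <= e)%N.
  apply: leq_trans (size_sum _ _ _) _; apply/bigmax_leqP => l _.
  by apply: leq_trans (size_scale_leq _ _) _; rewrite size_polyXn.
have Q0 : Q != 0.
  apply: (@sparse_sum_neq0 _ g g1) => //; first by rewrite deE leq_pred.
  exists i0.1; apply: contraNneq ci0 => /(congr1 (coefp i0.2)).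
  rewrite /= coef0 coef_sum (bigD1 i0.2) //= big1 ?addr0.
    by rewrite coefZ coefXn eqxx mulr1 -surjective_pairing => ->.
  by move=> l ne; rewrite coefZ coefXn val_eqE eq_sym (negbTE ne) mulr0.
have dvQ x : x \in X -> ('X - x%:P) ^+ M %| g ^+ M * Q.
  move=> /XP[xq gx0 gxu]; apply: dvdp_XsubC_exp_nderivn => k ltkM.
  have -> : g ^+ M * Q = \sum_(i : I) c i *:
      (g ^+ (M + i.1.1 * e) * 'X^(i.2) * ('X - b%:P) ^+ (q * i.1.2)).
    rewrite /Q mulr_sumr [RHS](eq_bigr (fun i : I => c (i.1, i.2) *:
      (g ^+ (M + i.1.1 * e) * 'X^(i.2) * ('X - b%:P) ^+ (q * i.1.2)))); last by case.
    rewrite -(pair_big xpredT xpredT (fun ij l => c (ij, l) *: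
      (g ^+ (M + ij.1 * e) * 'X^l * ('X - b%:P) ^+ (q * ij.2)))) /=.
    apply: eq_bigr => ij _; rewrite /r !mulr_suml mulr_sumr.
    apply: eq_bigr => l _; rewrite exprD -!scalerAl -!scalerAr; congr (_ *: _).
    ring.
  have -> : (\sum_(i : I) c i *: (g ^+ (M + i.1.1 * e) * 'X^(i.2)
        * ('X - b%:P) ^+ (q * i.1.2)))^`N(k) = \sum_(i : I) c i *:
      (g ^+ (M + i.1.1 * e - k) * H k i * ('X - b%:P) ^+ (q * i.1.2)).
    rewrite linear_sum; apply: eq_bigr => i _ /=.
    rewrite nderivnZ nderivnM big_ord_recr /= subnn nderivn0 big1 ?add0r.
      by have [<-] := HP k i ltkM.
    move=> l _; rewrite nderivn_pexpX ?mulr0 //.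
    by rewrite subn_gt0 ltn_ord (leq_ltn_trans (leq_subr _ _)) // -/q qE; lia.
  apply/rootP; rewrite horner_sum.
  have := congr1 (fun f => g.[x] ^+ (M - k) * f.[x]) (W0 k ltkM).
  rewrite horner0 mulr0 => E; rewrite -[RHS]E horner_sum mulr_sumr.
  apply: eq_bigr => i _.
  rewrite !(hornerZ, hornerM, horner_exp, hornerXsubC).
  have -> : (x - b ^+ q) = (x - b) ^+ q.
    have nat_q : [pchar F].-nat q by rewrite pnatX pnatE ?(pcharf_prime pF) ?pF.
    by rewrite exprDn_pchar // exprNn_pchar // xq.
  have -> : (M + i.1.1 * e - k = M - k + e * i.1.1)%N by lia.
  by rewrite exprD exprM gxu -exprM; ring.
have size_expg n : size (g ^+ n) = (n * m).+1.
  by rewrite -(prednK (_ : 0 < size (g ^+ n))%N) ?size_poly_gt0 ?expf_neq0 //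
    size_exp size_g mulnC.
have size_Q : (size Q <= e + d.-1 * e * m + q * (t + m))%N.
  apply: leq_trans (size_sum _ _ _) _; apply/bigmax_leqP => -[i j] _ /=.
  apply: leq_trans (size_polyMleq _ _) _; rewrite size_exp_XsubC addnS /=.
  apply: leq_add; last by rewrite leq_mul2l -ltnS -addnS ltn_ord orbT.
  apply: leq_trans (size_polyMleq _ _) _; rewrite size_expg addnS /=.
  by rewrite leq_add // !leq_mul2r -ltnS prednK // ltn_ord !orbT.
have := dvdp_prod_XsubC_exp uX dvQ.
move/(dvdp_leq (mulf_neq0 (expf_neq0 M g0) Q0)).
have -> : size (\prod_(x <- X) ('X - x%:P) ^+ M) = (size X * M).+1.
  rewrite prodrXl; set P := \prod_(x <- X) _.
  have P0 : (0 < size (P ^+ M)%R)%N.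
    by rewrite size_poly_gt0 monic_neq0 ?monic_exp ?monic_prod_XsubC.
  by rewrite -(prednK P0) size_exp size_prod_XsubC.
move=> le1.
have {}le1 : (size X * M < M * m + (e + d.-1 * e * m + q * (t + m)))%N.
  apply: leq_trans le1 _; apply: leq_trans (size_polyMleq _ _) _.
  by rewrite size_expg addSn /= leq_add2l.
(* Multiplying by d turns the d t and d e of the degree bound into M and q - 1; division by M then
   leaves q + O(s). *)
have : (d * size X * M <= M * (d * m) + q.-1 + d.-1 * q.-1 * m
                          + q * (M + d * m))%N.
  rewrite -mulnA; apply: leq_trans (leq_mul (leqnn d) (ltnW le1)) _.
  by apply/eq_leq; rewrite -deE -[X in _ = (_ + q * (X + _))%N]dt; ring.
have -> : q.-1 = (M * (M + 2))%N by rewrite qE sE; lia.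
move=> le2; rewrite -(leq_pmul2r M_gt0); apply: leq_trans le2 _.
have le_dm : (d.-1 * m <= d * m)%N by rewrite leq_mul2r leq_pred orbT.
have le_M : (d * m <= M * (d * m))%N by rewrite leq_pmull.
rewrite qE sE; have -> : (d.-1 * (M * (M + 2)) * m = M * (M + 2) * (d.-1 * m))%N.
  by ring.
rewrite -(mulnA 6); move: (d * m)%N (d.-1 * m)%N le_dm le_M => y z le_zy le_My.
apply: (@leq_trans (M * (y + (M + 2) + (M + 2) * y + (M.+1 * M.+1)
                         + (M + 2) * y + y))%N).
  have : (M * (M + 2) * z <= M * (M + 2) * y)%N by rewrite leq_mul2l le_zy orbT.
  have -> : (M.+1 * M.+1 * (M + y) = M.+1 * M.+1 * M + M * (M + 2) * y + y)%N.
    by rewrite -addn1; ring.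
  lia.
rewrite mulnC leq_pmul2r //; lia.
Qed.

(** * Frobenius orbits in an algebraic closure of F_p *)

Section FrobeniusOrbits.

Variables (p : nat) (p_pr : prime p) (K : closedFieldType).
Variable io : {rmorphism 'F_p -> K}.

Local Notation Gal := (fun G : {poly 'F_p} => map_poly io G).

Lemma pcharK : p \in [pchar K].
Proof. by rewrite (fmorph_pchar io) pchar_Fp. Qed.

Let p_gt0 : (0 < p)%N := prime_gt0 p_pr.
Let p_gt1 : (1 < p)%N := prime_gt1 p_pr.

Lemma pexpD n (x y : K) :
  (x + y) ^+ (p ^ n) = x ^+ (p ^ n) + y ^+ (p ^ n).
Proof. by rewrite exprDn_pchar // pnatX pnatE // pcharK. Qed.

Lemma pexpN n (x : K) : (- x) ^+ (p ^ n) = - x ^+ (p ^ n).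
Proof. by rewrite exprNn_pchar // pnatX pnatE // pcharK. Qed.

Lemma pexp_inj n : injective (fun x : K => x ^+ (p ^ n)).
Proof.
move=> x y /eqP; rewrite -subr_eq0 -pexpN -pexpD expf_eq0 subr_eq0.
by case/andP=> _ /eqP.
Qed.

Lemma pexpS n (x : K) : x ^+ (p ^ n.+1) = (x ^+ (p ^ n)) ^+ p.
Proof. by rewrite expnSr exprM. Qed.

(* The elements of the subfield F_{p^n} of K; meaningful for 0 < n only. *)
Definition ffix n : seq K := sval (closed_field_poly_normal ('X^(p ^ n) - 'X : {poly K})).

Lemma ffixE n : (0 < n)%N -> 'X^(p ^ n) - 'X = \prod_(x <- ffix n) ('X - x%:P).
Proof.
move=> n_gt0; rewrite /ffix; case: closed_field_poly_normal => s /= {1}->.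
have q_gt1 : (1 < p ^ n)%N by rewrite -{1}(expn0 p) ltn_exp2l.
by rewrite lead_coefDl ?size_polyXn ?size_polyN ?size_polyX // lead_coefXn scale1r.
Qed.

Lemma mem_ffix n x : (0 < n)%N -> (x \in ffix n) = (x ^+ (p ^ n) == x).
Proof.
by move=> n_gt0; rewrite -root_prod_XsubC -ffixE // rootE !hornerE subr_eq0.
Qed.

Lemma ffix_uniq n : (0 < n)%N -> uniq (ffix n).
Proof.
move=> n_gt0; rewrite -separable_prod_XsubC -ffixE // unlock.
have p0 : p%:R = 0 :> {poly K} by apply: pcharf0; rewrite pchar_poly pcharK.
rewrite derivB derivXn derivX -mulr_natr natrX p0 expr0n eqn0Ngt n_gt0.
rewrite mulr0 sub0r -[- 1]scaleN1r coprimepZr ?oppr_eq0 ?oner_eq0 //.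
by rewrite coprimep_sym coprime1p.
Qed.

Lemma size_ffix n : (0 < n)%N -> size (ffix n) = (p ^ n)%N.
Proof.
move=> n_gt0; apply/eqP; rewrite -eqSS -(size_prod_XsubC _ id) -ffixE //.
have q_gt1 : (1 < p ^ n)%N by rewrite -{1}(expn0 p) ltn_exp2l.
by rewrite size_polyDl ?size_polyXn ?size_polyN ?size_polyX.
Qed.

(* Inverse of the embedding io on the prime subfield; junk value 0 elsewhere. *)
Definition rho (x : K) : 'F_p := odflt 0 [pick a | io a == x].

Lemma ioK : cancel io rho.
Proof.
move=> a; rewrite /rho; case: pickP => [b /eqP/fmorph_inj//|/(_ a)].
by rewrite eqxx.
Qed.

Lemma rhoK x : x ^+ p = x -> io (rho x) = x.
Proof.
move=> xp; rewrite /rho; case: pickP => [b /eqP//|no].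
have := congr1 (fun P => (map_poly io P).[x]) (finField_genPoly 'F_p).
rewrite card_Fp // rmorphB rmorph_prod /= map_polyXn map_polyX !hornerE xp subrr.
rewrite horner_prod => /esym/eqP/prodf_eq0[a _].
rewrite rmorphB /= map_polyX map_polyC /= !hornerE subr_eq0 eq_sym.
by rewrite [_ == _](no a).
Qed.

(* The characteristic polynomial over F_p of x in F_{p^j}. *)
Definition orbpoly j (x : K) : {poly K} :=
  \prod_(i < j) ('X - (x ^+ (p ^ i))%:P).

Definition orbpolyF j x : {poly 'F_p} := map_poly rho (orbpoly j x).

Lemma frobK_fixed (P : {poly K}) :
  (forall i, P`_i ^+ p = P`_i) -> Gal (map_poly rho P) = P.
Proof.
move=> Pp; apply/polyP => i; rewrite coef_map /= coef_map_id0 ?rhoK //.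
by rewrite -[0](rmorph0 io) ioK.
Qed.

(** Frobenius shifts the factors cyclically, x^(p^j) = x closing the cycle; the coefficients are
    thus in the prime field, where [rho] inverts [io]. *)
Lemma orbpolyK j x : x \in ffix j -> (0 < j)%N -> Gal (orbpolyF j x) = orbpoly j x.
Proof.
move=> xj j_gt0; move: xj; rewrite mem_ffix // => /eqP xj.
apply: frobK_fixed => i; rewrite -(pFrobenius_autE pcharK) -coef_map /=.
rewrite rmorph_prod /=; congr (_`__); congr polyseq; rewrite /orbpoly.
case: j j_gt0 xj => // j _ xj.
rewrite big_ord_recr [RHS]big_ord_recl /= mulrC; congr (_ * _).
  by rewrite rmorphB /= map_polyX map_polyC /= pFrobenius_autE -pexpS xj expn0 expr1.
apply: eq_bigr => l _.
by rewrite rmorphB /= map_polyX map_polyC /= pFrobenius_autE -pexpS.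
Qed.

(** Frobenius acting on coefficients fixes G and sends (X - y)^k to (X - y^p)^k. *)
Lemma mup_frob (G : {poly 'F_p}) y i : G != 0 ->
  (mup y (Gal G) <= mup (y ^+ (p ^ i)) (Gal G))%N.
Proof.
move=> G0; elim: i => [|i IH]; first by rewrite expn0 expr1.
apply: leq_trans IH _; rewrite pexpS; move: (y ^+ _) => {}y.
have GK0 : Gal G != 0 by rewrite map_poly_eq0.
rewrite mup_geq //; have := leqnn (mup y (Gal G)); rewrite mup_geq // => dv.
rewrite -(pFrobenius_autE pcharK).
move: dv; rewrite -(dvdp_map (pFrobenius_aut pcharK)) rmorphXn rmorphB /=.
rewrite map_polyX map_polyC /= -map_poly_comp /=.
congr (_ %| _); apply: eq_map_poly => a /=.
rewrite pFrobenius_autE -rmorphXn /=; congr (io _).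
by have := expf_card a; rewrite card_Fp.
Qed.

Section Orbit.

Variables (G : {poly 'F_p}) (x : K).
Hypotheses (G0 : G != 0) (Gx : root (Gal G) x).

Let GK0 : Gal G != 0. Proof. by rewrite map_poly_eq0. Qed.

(** Pigeonhole: all the x^(p^i) are roots of G, so two of them coincide, and injectivity of
    Frobenius cancels the smaller exponent. *)
Lemma frob_period : exists2 d, (0 < d)%N & x ^+ (p ^ d) = x.
Proof.
pose s := [seq x ^+ (p ^ i) | i <- iota 0 (size (Gal G))].
have s_roots : all (root (Gal G)) s.
  apply/allP => _ /mapP[i _ ->]; rewrite -dvdp_XsubCl XsubC_dvd //.
  by apply: leq_trans (mup_frob _ _ G0); rewrite -XsubC_dvd // dvdp_XsubCl.
have : ~~ uniq s.
  apply/negP => us; have := max_poly_roots GK0 s_roots us.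
  by rewrite size_map size_iota ltnn.
case/(uniqPn 0) => i [j [ltij ltj]]; rewrite size_map size_iota in ltj.
rewrite !(nth_map 0%N) ?size_iota ?(ltn_trans ltij) //.
rewrite !nth_iota //; last exact: ltn_trans ltij _.
rewrite !add0n => e; exists (j - i)%N; first by rewrite subn_gt0.
apply: (@pexp_inj i); rewrite /= -exprM -expnD subnK ?e //; exact: ltnW.
Qed.

Lemma orbpoly_count n : size (Gal G) = n.+1 ->
  (\sum_(1 <= j < n.+1) ((x ^+ (p ^ j) == x)%R && (orbpoly j x %| Gal G)%R))%N
    = mup x (Gal G).
Proof.
move=> sizeG; set mu := mup x (Gal G).
have [d0 d0_gt0 xd0] := frob_period.
have exd : exists d, (0 < d)%N && (x ^+ (p ^ d) == x).
  by exists d0; rewrite d0_gt0 xd0 eqxx.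
case: (ex_minnP exd) => d /andP[d_gt0 /eqP xd] d_min {exd d0 d0_gt0 xd0}.
have xdk k : x ^+ (p ^ (d * k)) = x.
  by elim: k => [|k IH]; rewrite ?muln0 ?expr1 // mulnS expnD exprM xd IH.
have x_mod j : x ^+ (p ^ j) = x ^+ (p ^ (j %% d)).
  by rewrite {1}(divn_eq j d) mulnC expnD exprM xdk.
have x_fix j : (x ^+ (p ^ j) == x) = (d %| j)%N.
  rewrite x_mod /dvdn; apply/idP/eqP => [xj|->]; last by rewrite expr1.
  apply/eqP; rewrite -leqn0 leqNgt; apply/negP => j_gt0.
  have /d_min : (0 < j %% d)%N && (x ^+ (p ^ (j %% d)) == x) by rewrite j_gt0.
  by rewrite leqNgt ltn_pmod.
pose s := [seq x ^+ (p ^ i) | i <- iota 0 d].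
have us : uniq s.
  rewrite map_inj_in_uniq ?iota_uniq // => i j; rewrite !mem_iota !add0n /=.
  wlog lt_ij : i j / (i < j)%N => [W|] ltid ltjd e.
    have [lt|lt|//] := ltngtP i j; first exact: W.
    by apply/esym/W.
  have : x ^+ (p ^ (j - i)) == x.
    by apply/eqP/(@pexp_inj i); rewrite /= -exprM -expnD subnK ?e // ltnW.
  by rewrite x_fix => /dvdn_leq; rewrite subn_gt0 lt_ij => /(_ isT); lia.
have orb_d : orbpoly d x = \prod_(y <- s) ('X - y%:P).
  by rewrite /orbpoly big_map -[d in iota 0 d]subn0 big_mkord.
have orb_e e : orbpoly (d * e) x = orbpoly d x ^+ e.
  elim: e => [|e IH]; first by rewrite muln0 /orbpoly big_ord0.
  rewrite exprSr -IH mulnSr /orbpoly big_split_ord /=; congr (_ * _).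
  by apply: eq_bigr => i _; rewrite expnD exprM xdk.
have x_s : x \in s.
  by apply/mapP; exists 0%N; rewrite ?mem_iota // expr1.
have dvd_e e : (orbpoly (d * e) x %| Gal G) = (e <= mu)%N.
  rewrite orb_e orb_d; apply/idP/idP => [dv|le].
    rewrite mup_geq //; apply: dvdp_trans dv; apply: dvdp_exp2r.
    by rewrite dvdp_XsubCl root_prod_XsubC.
  rewrite -prodrXl; apply: (dvdp_prod_XsubC_exp (n := fun=> e)) => // y.
  case/mapP=> i _ ->; rewrite -(mup_geq _ e GK0).
  by apply: leq_trans le _; apply: mup_frob.
(* Guarantees that every j = d e with e <= mu lies in the range of summation. *)
have le_dmu : (d * mu <= n)%N.
  have := dvd_e mu; rewrite leqnn => /dvdp_leq => /(_ GK0).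
  rewrite sizeG orb_e orb_d; set P := \prod_(y <- s) _.
  have P0 : (0 < size (P ^+ mu)%R)%N.
    by rewrite size_poly_gt0 monic_neq0 ?monic_exp ?monic_prod_XsubC.
  by rewrite -(prednK P0) size_exp size_prod_XsubC size_map size_iota ltnS.
transitivity (count (fun j => (x ^+ (p ^ j) == x)%R && (orbpoly j x %| Gal G)%R)
                (index_iota 1 n.+1)).
  by rewrite -sum1_count [RHS]big_mkcond; apply: eq_bigr => j _; case: (_ && _).
rewrite -size_filter -[RHS](size_iota 1) -[RHS](size_map (muln d)).
apply/perm_size/uniq_perm.
- by rewrite filter_uniq // iota_uniq.
- rewrite map_inj_uniq ?iota_uniq // => i j /eqP.
  by rewrite eqn_pmul2l // => /eqP.
move=> j; rewrite mem_filter mem_index_iota x_fix; apply/idP/mapP.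
  case/andP=> /andP[/dvdnP[e ->]]; rewrite mulnC dvd_e => le_e.
  rewrite muln_gt0 => /andP[/andP[_ e_gt0] _]; exists e => //.
  by rewrite mem_iota e_gt0 add1n ltnS.
case=> e; rewrite mem_iota add1n ltnS => /andP[e_gt0 le_e] ->.
rewrite dvdn_mulr // dvd_e le_e muln_gt0 d_gt0 e_gt0 ltnS.
by apply: leq_trans le_dmu; rewrite leq_mul2l le_e orbT.
Qed.

End Orbit.

Lemma orbpoly_dvd_root (G : {poly 'F_p}) j x : (0 < j)%N ->
  orbpoly j x %| Gal G -> root (Gal G) x.
Proof.
case: j => // j _ dv; rewrite -dvdp_XsubCl; apply: dvdp_trans dv.
by rewrite /orbpoly big_ord_recl expn0 expr1 dvdp_mulIl.
Qed.

(* For a root x of period d, orbpoly j x divides G iff j = d e with e at most the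
   multiplicity of x; the sum thus counts the roots of G with multiplicity. *)
Lemma orbpoly_total (G : {poly 'F_p}) n : size G = n.+1 ->
  (\sum_(1 <= j < n.+1) count (fun x => orbpoly j x %| Gal G)%R (ffix j))%N = n.
Proof.
move=> sizeG; have G0 : G != 0 by rewrite -size_poly_gt0 sizeG.
have GK0 : Gal G != 0 by rewrite map_poly_eq0.
have sizeGK : size (Gal G) = n.+1 by rewrite size_map_poly.
have [s sE] := closed_field_poly_normal (Gal G).
have lc0 : lead_coef (Gal G) != 0 by rewrite lead_coef_eq0.
have size_s : size s = n.
  by apply/eqP; rewrite -eqSS -(size_prod_XsubC s id) -(size_scale _ lc0) -sE sizeGK.
have root_s x : (x \in s) = root (Gal G) x.
  by rewrite sE rootZ // root_prod_XsubC.
have mup_s x : mup x (Gal G) = count_mem x s.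
  rewrite sE -mul_polyC mupMr ?mu_prod_XsubC //.
  by rewrite rootC.
transitivity (\sum_(1 <= j < n.+1) \sum_(x <- undup s)
    ((x ^+ (p ^ j) == x)%R && (orbpoly j x %| Gal G)%R))%N.
  apply: eq_big_nat => j /andP[j_gt0 _].
  rewrite -big_mkcond /= sum1_count -!size_filter.
  apply/perm_size/uniq_perm; rewrite ?filter_uniq ?undup_uniq ?ffix_uniq //.
  move=> x; rewrite !mem_filter mem_undup root_s mem_ffix // andbC -andbA.
  case dv: (orbpoly j x %| Gal G); rewrite ?andbF //=.
  by rewrite (orbpoly_dvd_root j_gt0 dv) andbT.
rewrite exchange_big /= -[RHS]size_s.
transitivity (\sum_(x <- undup s) count_mem x s)%N.
  rewrite [LHS]big_seq [RHS]big_seq; apply: eq_bigr => x.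
  rewrite mem_undup root_s => Gx.
  by rewrite orbpoly_count // mup_s.
rewrite -[RHS]sum1_size; under eq_bigr => x _ do rewrite -sum1_count.
rewrite (exchange_big_dep xpredT) //= big_seq [RHS]big_seq.
apply: eq_bigr => y ys.
rewrite sum1_count (@eq_count _ _ (pred1 y)) => [|z]; last by rewrite /= eq_sym.
by rewrite count_uniq_mem ?undup_uniq // mem_undup ys.
Qed.

End FrobeniusOrbits.

Lemma size_monicB (R : nzRingType) n (G : {poly R}) :
  G \is monic -> size G = n.+1 -> (size (G - 'X^n)%R <= n)%N.
Proof.
move=> monG sizeG; apply/leq_sizeP => i.
rewrite leq_eqVlt coefB coefXn => /orP[/eqP<-|lt].
  by rewrite eqxx -[n]/(n.+1.-1) -sizeG -lead_coefE (monicP monG) subrr.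
by rewrite nth_default ?sizeG // gtn_eqF // subrr.
Qed.

(** The sum of the roots is additive in products. Multiplication by 'X shifts the index, so that
    degree 0 obeys the same formula. *)
Lemma coef_monicM_next (R : comNzRingType) n k (G H : {poly R}) :
    G \is monic -> size G = n.+1 -> H \is monic -> size H = k.+1 ->
  ('X * (G * H))`_(n + k) = ('X * G)`_n + ('X * H)`_k.
Proof.
move=> monG /(size_monicB monG) + monH /(size_monicB monH).
rewrite -{2 3}[G](subrK 'X^n) -{2 3}[H](subrK 'X^k).
move: (G - _) (H - _) => g h {G H monG monH} sg sh; rewrite ![_ + 'X^_]addrC.
have -> : 'X * (('X^n + g) * ('X^k + h)) =
    'X * 'X^n * 'X^k + 'X * g * 'X^k + 'X * h * 'X^n + 'X * (g * h).
  by ring.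
have X1 i : ('X * 'X^i : {poly R})`_i = 0 by rewrite -exprS coefXn; case: eqP => //; lia.
have -> : ('X * ('X^n + g))`_n = ('X * g)`_n by rewrite mulrDr coefD X1 add0r.
have -> : ('X * ('X^k + h))`_k = ('X * h)`_k by rewrite mulrDr coefD X1 add0r.
rewrite !coefD -mulrA -exprD X1 add0r.
have -> : ('X * g * 'X^k)`_(n + k) = ('X * g)`_n.
  by rewrite coefMXn ltnNge leq_addl addnK.
have -> : ('X * h * 'X^n)`_(n + k) = ('X * h)`_k.
  by rewrite coefMXn ltnNge leq_addr addKn.
rewrite [X in _ + X]nth_default ?addr0 //.
have [g0|g0] := eqVneq g 0; first by rewrite g0 mul0r mulr0 size_poly0.
move: (g0); rewrite -size_poly_gt0 => g_gt0.
have := size_polyMleq 'X (g * h); have := size_polyMleq g h.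
by rewrite size_polyX; move: (size _) (size _) (size _) (size _) g_gt0 sg sh; lia.
Qed.

(** * The L-function of a twisted character sum *)

Section MonicPolynomials.

Variable F : finFieldType.

(** The lower coefficients form a row vector, which makes the monic polynomials of degree n a finite
    type to sum over. *)
Definition monpoly n (v : 'rV[F]_n) : {poly F} := 'X^n + rVpoly v.

Lemma size_monpoly n (v : 'rV[F]_n) : size (monpoly v) = n.+1.
Proof. by rewrite /monpoly size_polyDl ?size_polyXn // ltnS size_poly. Qed.

Lemma monpoly_monic n (v : 'rV[F]_n) : monpoly v \is monic.
Proof.
by rewrite monicE /monpoly lead_coefDl ?lead_coefXn // size_polyXn ltnS size_poly.
Qed.

Lemma monpolyK n (v : 'rV[F]_n) : poly_rV (monpoly v - 'X^n) = v.
Proof. by rewrite /monpoly addrC addKr rVpolyK. Qed.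

Lemma poly_rV_monic n (G : {poly F}) : G \is monic -> size G = n.+1 ->
  monpoly (poly_rV (G - 'X^n) : 'rV_n) = G.
Proof.
move=> monG sizeG; rewrite /monpoly poly_rV_K ?subrKC //; exact: size_monicB.
Qed.

End MonicPolynomials.

Section Lfunction.

Variables (p : nat) (p_pr : prime p) (K : closedFieldType).
Variable io : {rmorphism 'F_p -> K}.
Variables (C : fieldType) (chi psi : 'F_p -> C) (B : seq 'F_p).

Hypothesis chi1 : chi 1 = 1.
Hypothesis chiM : {morph chi : x y / x * y}.
Hypothesis psi0 : psi 0 = 1.
Hypothesis psiD : {morph psi : x y / x + y >-> x * y}.
Hypothesis chi_sum : \sum_x chi x = 0.
Hypothesis p_neq0 : p%:R != 0 :> C.

(* For G monic of degree n, the coefficient of degree n of 'X * G is the one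
   following the leading coefficient of G, and it is 0 when n = 0.  If G has the
   roots x_i, this is the product over i and b of chi (b - x_i), times
   psi (\sum_i x_i). *)
Definition polychar n (G : {poly 'F_p}) : C :=
  (\prod_(b <- B) chi G.[b]) * psi (- ('X * G)`_n).

Lemma polycharM n k (G H : {poly 'F_p}) :
    G \is monic -> size G = n.+1 -> H \is monic -> size H = k.+1 ->
  polychar (n + k) (G * H) = polychar n G * polychar k H.
Proof.
move=> monG sG monH sH; rewrite /polychar mulrACA -psiD -opprD -big_split /=.
congr (_ * psi (- _)); first by apply: eq_bigr => b _; rewrite hornerM chiM.
exact: coef_monicM_next.
Qed.

(** The n-th coefficient of the L-function. *)
Definition csum n : C := \sum_(v : 'rV['F_p]_n) polychar n (monpoly v).

Lemma csum0 : csum 0 = 1.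
Proof.
rewrite /csum (big_pred1 0) => [|v]; last by rewrite /= [v]thinmx0 eqxx.
rewrite /polychar /monpoly linear0 addr0 mulr1 coefX oppr0 psi0 mulr1.
by rewrite big1_seq // => b _; rewrite hornerE chi1.
Qed.

(* Adding multiples of the product of the X - b, b <> b1, only changes the value
   at b1, over which chi averages to 0. *)
Lemma csum_eq0 n : uniq B -> B != [::] -> (size B < n)%N -> csum n = 0.
Proof.
rewrite /csum /polychar; case: B => [//|b1 B'] /andP[b1B' uB'] _ /= ltBn.
pose D := \prod_(b <- B') ('X - b%:P).
have sizeD : size D = (size B').+1 by rewrite size_prod_XsubC.
have D1 : D.[b1] != 0 by rewrite -[_ == _]/(root D b1) root_prod_XsubC.
have DB b : b \in B' -> D.[b] = 0.
  by move=> bB'; apply/rootP; rewrite root_prod_XsubC.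
have shiftE t (v : 'rV['F_p]_n) :
    monpoly (v + t *: poly_rV D) = monpoly v + t *: D.
  by rewrite /monpoly linearD linearZ /= poly_rV_K ?addrA // sizeD ltnW.
apply: (mulfI p_neq0); rewrite mulr0 -{1}(card_Fp p_pr) -sum1_card natr_sum.
rewrite mulr_suml.
transitivity (\sum_(t : 'F_p) \sum_(v : 'rV['F_p]_n)
  (chi ((monpoly v).[b1] + t * D.[b1]) *
    (\prod_(b <- B') chi (monpoly v).[b] * psi (- ('X * monpoly v)`_n)))).
  apply: eq_bigr => t _; rewrite mul1r.
  rewrite (reindex_inj (addIr (t *: poly_rV D))) /=; apply: eq_bigr => v _.
  rewrite shiftE big_cons hornerD hornerZ -mulrA; congr (_ * (_ * psi (- _))).
    rewrite big_seq [RHS]big_seq; apply: eq_bigr => b bB'.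
    by rewrite hornerD hornerZ DB // mulr0 addr0.
  (* D has degree below n - 1, so adding multiples of it leaves the argument of psi unchanged. *)
  rewrite mulrDr coefD -scalerAr coefZ [X in _ + _ * X]nth_default ?mulr0 ?addr0 //.
  by rewrite mulrC size_mulX ?sizeD // -size_poly_gt0 sizeD.
rewrite exchange_big /=; apply: big1 => v _; rewrite -mulr_suml.
rewrite (_ : \sum_t _ = 0) ?mul0r // -[RHS]chi_sum.
rewrite [RHS](reindex_inj (_ : injective (fun t => (monpoly v).[b1] + t * D.[b1]))) //.
by move=> x y /addrI /(mulIf D1).
Qed.

(** The sum over F_(p^j) of chi of norms times psi of traces, as [polychar_orbpoly] makes explicit;
    up to sign it is the j-th power sum of the reciprocal roots. *)
Definition psum j : C := \sum_(x <- ffix p K j) polychar j (orbpolyF io j x).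

(** The logarithmic derivative of the L-function, in coefficients and without an Euler product:
    [orbpoly_total] writes the degree n of a monic G as a number of pairs (j, x) whose orbit
    polynomial divides G, and multiplicativity then splits G into that divisor and a monic cofactor
    of degree n - j. *)
Lemma csum_rec n :
  n%:R * csum n = \sum_(1 <= j < n.+1) psum j * csum (n - j).
Proof.
rewrite mulr_sumr.
transitivity (\sum_(v : 'rV['F_p]_n) \sum_(1 <= j < n.+1) \sum_(x <- ffix p K j)
    (if orbpolyF io j x %| monpoly v then polychar n (monpoly v) else 0)).
  apply: eq_bigr => v _.
  rewrite -{1}(orbpoly_total p_pr io (size_monpoly v)) natr_sum mulr_suml.
  apply: eq_big_nat => j /andP[j_gt0 _].
  rewrite -sum1_count natr_sum mulr_suml big_mkcond /=.
  rewrite [LHS]big_seq [RHS]big_seq; apply: eq_bigr => x xj.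
  rewrite -(orbpolyK p_pr io xj j_gt0) dvdp_map.
  by case: ifP => _; rewrite ?mul1r.
rewrite exchange_big /=; apply: eq_big_nat => j /andP[j_gt0 le_jn].
rewrite exchange_big /= /psum mulr_suml.
rewrite [LHS]big_seq [RHS]big_seq; apply: eq_bigr => x xj.
have gE := orbpolyK p_pr io xj j_gt0; set g := orbpolyF io j x in gE *.
have mon_g : g \is monic.
  by rewrite -(map_monic io) gE /orbpoly monic_prod_XsubC.
have size_g : size g = j.+1.
  rewrite -(size_map_poly io) gE /orbpoly size_prod_XsubC.
  by rewrite /index_enum -enumT size_enum_ord.
have jnE : (j + (n - j) = n)%N by rewrite subnKC.
have size_gw (w : 'rV['F_p]_(n - j)) : size (g * monpoly w) = n.+1.
  by rewrite size_monicM ?monic_neq0 ?monpoly_monic // size_g size_monpoly /= addnS jnE.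
have mon_gw (w : 'rV['F_p]_(n - j)) : g * monpoly w \is monic.
  by rewrite monicMl ?monpoly_monic.
rewrite -big_mkcond /= /csum mulr_sumr.
rewrite (reindex_onto (fun w : 'rV_(n - j) => poly_rV (g * monpoly w - 'X^n))
  (fun v => poly_rV (monpoly v %/ g - 'X^(n - j)))) /=; last first.
  move=> v dv; rewrite -[RHS]monpolyK -[in RHS](divpK dv) mulrC; congr poly_rV.
  have mon_q : monpoly v %/ g \is monic.
    by rewrite -(monicMr _ mon_g) divpK ?monpoly_monic.
  congr (_ * _ - _); apply: poly_rV_monic => //.
  have := size_monpoly v; rewrite -{1}(divpK dv) size_Mmonic ?monic_neq0 //.
  by rewrite size_g addnS /=; move: (size _) => z E; lia.
apply: eq_big => w.
  rewrite poly_rV_monic // dvdp_mulIl /=.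
  by rewrite mulKp ?monic_neq0 // monpolyK eqxx.
by move=> _; rewrite poly_rV_monic // -polycharM ?monpoly_monic ?size_monpoly // jnE.
Qed.

End Lfunction.

(** * Newton's identities and the growth of power sums *)

Section PowerSums.

Variable C : closedFieldType.

Lemma newton_identity (s : seq C) n :
  let e i := (\prod_(w <- s) (1 - w%:P * 'X))`_i in
  n.+1%:R * e n.+1
    = - \sum_(i < n.+1) (\sum_(w <- s) w ^+ i.+1) * e (n - i)%N.
Proof.
elim: s n => [|w s IH] n /=.
  rewrite big_nil coefC mulr0 big1 ?oppr0 // => i _; by rewrite big_nil mul0r.
pose e i := (\prod_(w <- s) (1 - w%:P * 'X))`_i.
pose e' i := (\prod_(w <- w :: s) (1 - w%:P * 'X))`_i.
have e'0 : e' 0%N = e 0%N.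
  by rewrite /e' big_cons mulrBl mul1r coefB -mulrA coefCM coefXM mulr0 subr0.
have e'S i : e' i.+1 = e i.+1 - w * e i.
  by rewrite /e' big_cons mulrBl mul1r coefB -mulrA coefCM coefXM.
(* The generating series of e' is that of e times 1 - w X, and the sum multiplies it back by w / (1
   - w X). *)
have sum1 k : \sum_(i < k.+1) w ^+ i.+1 * e' (k - i)%N = w * e k.
  elim: k => [|k IHk]; first by rewrite big_ord_recl big_ord0 addr0 expr1 e'0.
  rewrite big_ord_recl /= subn0 e'S expr1.
  under eq_bigr => i _ do rewrite /bump leq0n add1n subSS exprS -mulrA.
  by rewrite -mulr_sumr IHk; ring.
have sum2 : \sum_(i < n.+1) (\sum_(w <- s) w ^+ i.+1) * e' (n - i)%N
    = - (n.+1%:R * e n.+1) + w * (n%:R * e n).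
  rewrite IH opprK; case: n => [|n].
    by rewrite !big_ord_recl !big_ord0 !addr0 e'0 mul0r mulr0 addr0.
  rewrite big_ord_recr /= subnn e'0.
  rewrite [in RHS]big_ord_recr /= subnn addrAC; congr (_ + _).
  rewrite IH mulrN mulr_sumr -sumrB; apply: eq_bigr => i _.
  by rewrite subSn ?e'S -/(e _) -?/(e _.+1) -1?ltnS ?ltn_ord //; ring.
rewrite -[LHS]/(n.+1%:R * e' n.+1).
under eq_bigr => i _ do rewrite big_cons mulrDl -/(e' _).
rewrite big_split /= sum1 sum2 e'S -natr1; ring.
Qed.

(** The list s consists of the inverses of the roots of the polynomial L with coefficients c; they
    exist because L(0) = 1. By Newton's identities, S and the negated power sums of s obey the same
    recurrence, in which the newest term has coefficient [c 0] = 1. *)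
Lemma power_sums_of_recurrence (c S : nat -> C) m :
    [pchar C] =i pred0 -> c 0%N = 1 -> (forall n, (m < n)%N -> c n = 0) ->
    (forall n, n.+1%:R * c n.+1 = \sum_(i < n.+1) S i.+1 * c (n - i)%N) ->
  exists2 s : seq C, (size s <= m)%N &
    forall n, S n.+1 = - \sum_(w <- s) w ^+ n.+1.
Proof.
move=> charC c0 cm cS; pose L := \poly_(i < m.+1) c i.
have Li i : L`_i = c i.
  by rewrite coef_poly ltnS; case: leqP => // /cm->.
have L0 : L != 0.
  by apply: contraTneq (oner_neq0 C) => L0; rewrite -c0 -Li L0 coef0 eqxx.
have [r rE] := closed_field_poly_normal L.
have lc0 : lead_coef L != 0 by rewrite lead_coef_eq0.
have r0 z : z \in r -> z != 0.
  move=> zr; have : root L z by rewrite rE rootZ // root_prod_XsubC.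
  apply: contraTneq => ->; rewrite /root horner_coef0 Li c0; exact: oner_neq0.
pose s := [seq z^-1 | z <- r].
have [a LE] : exists a, L = a *: \prod_(w <- s) (1 - w%:P * 'X).
  exists (lead_coef L * \prod_(z <- r) (- z)).
  rewrite {1}rE -scalerA; congr (_ *: _).
  rewrite big_map -mul_polyC rmorph_prod -big_split /=.
  rewrite big_seq [RHS]big_seq; apply: eq_bigr => z zr.
  by rewrite mulrBr mulr1 mulrA -polyCM mulNr mulfV ?r0 // !polyCN polyC1; ring.
have a1 : a = 1.
  rewrite -c0 -Li LE coefZ -horner_coef0 horner_prod big1 ?mulr1 // => w _.
  by rewrite !hornerE ?mulr0 ?subr0.
rewrite {a}a1 scale1r in LE.
exists s.
  rewrite size_map -ltnS -(size_prod_XsubC r id) -(size_scale _ lc0) -rE.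
  exact: size_poly.
elim/ltn_ind => n IH; have := newton_identity s n; rewrite -LE /= !Li cS.
rewrite big_ord_recr [in RHS]big_ord_recr /= subnn !Li c0 !mulr1 opprD.
rewrite -[X in _ = X - _]sumrN.
rewrite [X in _ = X - _](eq_bigr (fun i : 'I_n => S i.+1 * c (n - i)%N)).
  exact: addrI.
by move=> i _; rewrite IH // Li mulNr.
Qed.

End PowerSums.

Section Radius.

Variable R : realType.
Local Notation C := R[i].

Lemma exprn_unbounded (x M : R) : 1 < x -> exists n, M < x ^+ n.
Proof.
move=> x1; have d0 : 0 < x - 1 by rewrite subr_gt0.
have bernoulli n : 1 + n%:R * (x - 1) <= x ^+ n.
  elim: n => [|n IH]; first by rewrite mul0r addr0 expr0.
  rewrite exprS; apply: (@le_trans _ _ (x * (1 + n%:R * (x - 1)))).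
    rewrite -subr_ge0 -natr1 (_ : _ - _ = n%:R * (x - 1) ^+ 2); last by ring.
    by rewrite mulr_ge0 ?sqr_ge0.
  by rewrite ler_wpM2l // ltW // (lt_trans ltr01).
exists (Num.bound `|M / (x - 1)|); apply: lt_le_trans (bernoulli _).
have lt : M / (x - 1) < (Num.bound `|M / (x - 1)|)%:R.
  exact: le_lt_trans (ler_norm _) (archi_boundP (normr_ge0 _)).
by rewrite ltr_pdivrMr // in lt; apply: lt_le_trans lt _; rewrite lerDr.
Qed.

Lemma normc_sum (I : Type) (r : seq I) (P : pred I) (f : I -> C) :
  normc (\sum_(i <- r | P i) f i) <= \sum_(i <- r | P i) normc (f i).
Proof.
elim/big_rec2: _ => [|i y1 y2 _ le]; first by rewrite normc0.
by apply: le_trans (le_normcD _ _) _; rewrite lerD2l.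
Qed.

Lemma normcX (x : C) n : normc (x ^+ n) = normc x ^+ n.
Proof. by elim: n => [|n IH]; rewrite ?expr0 ?normc1 // !exprS normcM IH. Qed.

Lemma normc_ge0 (x : C) : 0 <= normc x.
Proof. by case: x => a b; apply: sqrtr_ge0. Qed.

Lemma normc_nat n : normc (n%:R : C) = n%:R.
Proof. by rewrite -(rmorph_nat (real_complex R)) /= expr0n addr0 sqrtr_sqr ger0_norm. Qed.

(* The polynomial Q vanishing at the other elements of s turns the power sums
   into a multiple of w^h. *)
Lemma power_sum_radius (s : seq C) (B rho : R) : 0 < rho ->
    (forall h, normc (\sum_(w <- s) w ^+ h.+1) <= B * rho ^+ h.+1) ->
  forall w, w \in s -> normc w <= rho.
Proof.
move=> rho0 bound w ws; rewrite leNgt; apply/negP => lt_rho.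
pose Q := \prod_(z <- rem w (undup s)) ('X - z%:P).
have Qw : Q.[w] != 0.
  rewrite -[_ == _]/(root Q w) root_prod_XsubC mem_rem_uniqF ?undup_uniq //.
have Qz z : z \in s -> z != w -> Q.[z] = 0.
  move=> zs zw; apply/rootP; rewrite root_prod_XsubC mem_rem_uniq ?undup_uniq //.
  by rewrite inE zw mem_undup.
pose k := normc ((count_mem w s)%:R * Q.[w]).
have k0 : 0 < k.
  rewrite lt_def normc_ge0 andbT; apply: contraNneq Qw => /eq0_normc/eqP.
  rewrite mulf_eq0 pnatr_eq0 => /orP[|//].
  by rewrite eqn0Ngt -has_count has_pred1 ws.
pose B' := \sum_(j < size Q) normc Q`_j * (B * rho ^+ j).
have H h : k * normc w ^+ h.+1 <= B' * rho ^+ h.+1.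
  rewrite -normcX -normcM.
  have -> : (count_mem w s)%:R * Q.[w] * w ^+ h.+1
      = \sum_(j < size Q) Q`_j * \sum_(z <- s) z ^+ (j + h).+1.
    transitivity (\sum_(z <- s) Q.[z] * z ^+ h.+1).
      rewrite (bigID (pred1 w)) /= [X in _ = _ + X]big1_seq ?addr0 => [|z /andP[zw zs]].
        rewrite (eq_bigr (fun=> Q.[w] * w ^+ h.+1)) => [|z /eqP->] //.
        by rewrite big_const_seq iter_addr_0 -[RHS]mulr_natl mulrA.
      by rewrite Qz ?mul0r.
    under [RHS]eq_bigr => j _ do rewrite mulr_sumr.
    rewrite exchange_big /=; apply: eq_bigr => z _.
    rewrite horner_coef mulr_suml; apply: eq_bigr => j _.
    by rewrite -addnS exprD mulrA.
  apply: le_trans (normc_sum _ _ _) _; rewrite /B' mulr_suml.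
  apply: ler_sum => j _; rewrite normcM -mulrA ler_wpM2l ?normc_ge0 //.
  by apply: le_trans (bound _) _; rewrite -mulrA -exprD addnS.
have [|n] := @exprn_unbounded (normc w / rho) (B' / k).
  by rewrite ltr_pdivlMr ?mul1r.
apply/negP; rewrite -leNgt expr_div_n ler_pdivrMr ?exprn_gt0 // mulrAC ler_pdivlMr //.
have w0 : 0 < normc w by apply: lt_trans lt_rho.
rewrite mulrC; apply: le_trans (_ : k * normc w ^+ n.+1 / normc w <= _).
  by rewrite exprSr mulrA mulfK ?gt_eqF // mulrC.
have B'0 : 0 <= B'.
  have := H 0%N; have : 0 <= k * normc w ^+ 1 by rewrite mulr_ge0 // ltW.
  by move=> le1 le2; have := le_trans le1 le2; rewrite pmulr_lge0.
apply: le_trans (_ : B' * rho ^+ n.+1 / normc w <= _).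
  by rewrite ler_wpM2r ?invr_ge0 ?normc_ge0.
rewrite ler_pdivrMr // exprSr mulrA ler_wpM2l //; last exact: ltW.
by rewrite mulr_ge0 // exprn_ge0 // ltW.
Qed.

End Radius.

(** * Weil's bound *)

Section ExponentialSums.

Variables (p : nat) (p_pr : prime p) (K : closedFieldType).
Variable io : {rmorphism 'F_p -> K}.
Variable R : realType.
Local Notation C := R[i].
Local Notation ffix := (ffix p K).
Local Notation rho := (rho io).

Let p_gt0 : (0 < p)%N := prime_gt0 p_pr.
Let p_gt1 : (1 < p)%N := prime_gt1 p_pr.

Lemma simple_root_factor (g : {poly K}) b : root g b -> ~~ root g^`() b ->
  exists2 g1, g = ('X - b%:P) * g1 & ~~ root g1 b.
Proof.
move=> /factor_theorem[g1 ->]; rewrite derivM derivXsubC mulr1 => nr.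
exists g1; first exact: mulrC.
by apply: contra nr; rewrite /root !hornerE subrr mulr0 add0r.
Qed.

Definition trace n (x : K) : K := \sum_(i < n) x ^+ (p ^ i).

Lemma traceB n x y : trace n (x - y) = trace n x - trace n y.
Proof.
by rewrite /trace -sumrB; apply: eq_bigr => i _; rewrite (pexpD p_pr io) (pexpN p_pr io).
Qed.

Lemma trace_artin_schreier n z : trace n (z ^+ p - z) = z ^+ (p ^ n) - z.
Proof.
elim: n => [|n IH]; first by rewrite /trace big_ord0 expr1 subrr.
rewrite /trace big_ord_recr /= -/(trace _ _) IH (pexpD p_pr io) (pexpN p_pr io).
by rewrite -exprM -expnS addrC addrA subrK.
Qed.

Lemma ffixB n x y : (0 < n)%N -> x \in ffix n -> y \in ffix n -> x - y \in ffix n.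
Proof.
move=> n0; rewrite !(mem_ffix p_pr) // (pexpD p_pr io) (pexpN p_pr io).
by move=> /eqP-> /eqP->.
Qed.

Lemma ffixD n x y : (0 < n)%N -> x \in ffix n -> y \in ffix n -> x + y \in ffix n.
Proof.
by move=> n0; rewrite !(mem_ffix p_pr) // (pexpD p_pr io) => /eqP-> /eqP->.
Qed.

Lemma ffixM n x y : (0 < n)%N -> x \in ffix n -> y \in ffix n -> x * y \in ffix n.
Proof.
by move=> n0; rewrite !(mem_ffix p_pr) // exprMn => /eqP-> /eqP->.
Qed.

Lemma ffixX n x k : (0 < n)%N -> x \in ffix n -> x ^+ k \in ffix n.
Proof.
by move=> n0; rewrite !(mem_ffix p_pr) // exprAC => /eqP->.
Qed.

Lemma ffix_io n a : (0 < n)%N -> io a \in ffix n.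
Proof.
move=> n0; rewrite (mem_ffix p_pr) // -rmorphXn /=; apply/eqP; congr (io _).
elim: n {n0} => [|n IH]; first by rewrite expr1.
by rewrite (expnSr p n) exprM IH; have := expf_card a; rewrite card_Fp.
Qed.

(** Additive Hilbert 90: a solution z0 in the closure satisfies z0^(p^n) - z0 = trace x = 0, hence
    lies in F_(p^n), and the solutions are the z0 + a with a in F_p. *)
Lemma artin_schreier_count n x : (0 < n)%N -> trace n x = 0 ->
  count (fun z => z ^+ p - z == x) (ffix n) = p.
Proof.
move=> n0 trx.
have [z0 z0x] : exists z0, z0 ^+ p - z0 = x.
  have : size ('X^p - 'X - x%:P : {poly K}) != 1%N.
    have lt : (size (- 'X - x%:P : {poly K})%R < size ('X^p : {poly K})%R)%N.
      rewrite -opprD size_polyN size_polyXn size_polyDl size_polyX ?ltnS //.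
      exact: size_polyC_leq1.
    by rewrite -addrA size_polyDl // size_polyXn eqSS -lt0n.
  case/closed_rootP=> z0; rewrite rootE !hornerE subr_eq0 => /eqP z0x.
  by exists z0.
have z0n : z0 \in ffix n.
  by rewrite (mem_ffix p_pr) // -subr_eq0 -trace_artin_schreier z0x trx.
rewrite -size_filter -[RHS](card_Fp p_pr) cardE -(size_map (fun a => z0 + io a)).
apply/perm_size/uniq_perm.
- by rewrite filter_uniq // (ffix_uniq p_pr io).
- by rewrite map_inj_uniq ?enum_uniq // => a b /addrI/fmorph_inj.
move=> z; rewrite mem_filter; apply/andP/mapP => [[/eqP zx zn]|[a _ ->]].
  exists (rho (z - z0)); first by rewrite mem_enum.
  rewrite (rhoK p_pr) ?subrKC //.
  have := pexpD p_pr io 1 z (- z0); rewrite expn1 => ->.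
  have := pexpN p_pr io 1 z0; rewrite expn1 => ->.
  apply/eqP; rewrite -subr_eq0; apply/eqP.
  by rewrite -[0](subrr x) -{1}zx -z0x; ring.
have a_p : io a ^+ p = io a.
  have := ffix_io a (ltnSn 0); rewrite (mem_ffix p_pr) // expn1 => /eqP E; exact: E.
split; last by rewrite ffixD ?ffix_io.
have := pexpD p_pr io 1 z0 (io a); rewrite expn1 => ->.
by rewrite a_p -z0x; apply/eqP; ring.
Qed.

(** On F_(p^n) the map z -> z^p - z + c is p-to-one onto the elements with the trace of c. *)
Lemma artin_schreier_sum n c (T : K -> C) : (0 < n)%N -> c \in ffix n ->
  \sum_(z <- ffix n) T (z ^+ p - z + c)
    = p%:R * \sum_(x <- ffix n | trace n x == trace n c) T x.
Proof.
move=> n0 cn; pose P x := trace n x == trace n c.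
have fib z : z \in ffix n ->
    T (z ^+ p - z + c) =
    \sum_(x <- ffix n | P x) (if z ^+ p - z == x - c then T x else 0).
  move=> zn; set y := z ^+ p - z + c.
  have yn : y \in ffix n.
    by rewrite /y ffixD ?ffixB ?ffixX.
  have Py : P y.
    apply/eqP/eqP; rewrite -subr_eq0 -traceB addrK trace_artin_schreier.
    by rewrite (mem_ffix p_pr) // in zn; rewrite (eqP zn) subrr.
  rewrite -big_mkcondr -big_filter (perm_big [:: y]) ?big_seq1 //.
  apply: uniq_perm; rewrite ?filter_uniq ?(ffix_uniq p_pr io) // => x.
  rewrite mem_filter inE [z ^+ p - z == _]eq_sym subr_eq -/y.
  by case: eqP => [->|]; rewrite ?andbF // Py yn.
rewrite big_seq (eq_bigr _ fib) -big_seq exchange_big /= mulr_sumr.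
apply: eq_bigr => x /eqP Px.
rewrite -big_mkcond /= big_const_seq iter_addr_0 artin_schreier_count //.
  by rewrite mulr_natl.
by rewrite traceB Px subrr.
Qed.

Lemma rho0 : rho 0 = 0.
Proof. by rewrite -{1}(rmorph0 io) ioK. Qed.

Lemma rho_pexp n e (y : K) : (0 < n)%N -> y \in ffix n -> y != 0 ->
  (p.-1 * e = (p ^ n).-1)%N -> io (rho (y ^+ e)) = y ^+ e.
Proof.
move=> n0 yn y0 eE; apply: (rhoK p_pr).
rewrite -exprM -(prednK p_gt0) mulnS mulnC eE exprD (_ : y ^+ _.-1 = 1) ?mulr1 //.
apply: (mulfI y0); rewrite -exprS prednK ?expn_gt0 ?p_gt0 // mulr1.
by apply/eqP; rewrite -(mem_ffix p_pr).
Qed.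

(** The exponent of the norm from F_(p^(2h)) to F_p factors as t (p^h + 1), the shape that
    [stepanov_bound] exploits. *)
Lemma norm_exponent h t : (p.-1 * t = (p ^ h).-1)%N ->
  (p.-1 * (t * (p ^ h).+1) = (p ^ (2 * h)).-1)%N.
Proof.
move=> tE; rewrite mulnA tE mul2n -addnn expnD.
by case: (p ^ h)%N (expn_gt0 p h) => [|a _]; rewrite ?p_gt0 //=; lia.
Qed.

(** * Multiplicative character sums in even degree *)

Section PureSum.

Variables (h t m : nat) (g : {poly K}) (b : K).
Hypotheses (h_gt0 : (0 < h)%N) (tE : (p.-1 * t = (p ^ h).-1)%N).
Hypotheses (size_g : size g = m.+1) (gb : root g b) (gb' : ~~ root g^`() b).
Let n := (2 * h)%N.
Let e := (t * (p ^ h).+1)%N.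
Hypothesis g_ffix : forall z, z \in ffix n -> g.[z] \in ffix n.

Let n_gt0 : (0 < n)%N. Proof. by rewrite /n muln_gt0. Qed.

Let cnt u := count (fun z => (g.[z] != 0) && (g.[z] ^+ e == io u)) (ffix n).

(** The values are in a general additive monoid in order to serve both for summing chi and, with T =
    1 in [nat], for counting points. *)
Lemma sum_by_value (V : nmodType) (T : 'F_p -> V) :
  \sum_(z <- ffix n | g.[z] != 0) T (rho (g.[z] ^+ e))
    = \sum_(u | u != 0) T u *+ cnt u.
Proof.
transitivity (\sum_(z <- ffix n | g.[z] != 0) \sum_(u | u != 0)
   (if g.[z] ^+ e == io u then T u else 0)).
  rewrite big_seq_cond [RHS]big_seq_cond; apply: eq_bigr => z /andP[zn gz].
  have yE := rho_pexp n_gt0 (g_ffix zn) gz (norm_exponent tE).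
  rewrite -big_mkcondr (big_pred1 (rho (g.[z] ^+ e))) // => u /=.
  have -> : (g.[z] ^+ e == io u) = (u == rho (g.[z] ^+ e)).
    by rewrite -{1}yE (inj_eq (fmorph_inj io)) eq_sym.
  rewrite andbC; case: eqP => [->|//] /=.
  by rewrite -(fmorph_eq0 io) yE expf_neq0.
rewrite exchange_big /=; apply: eq_bigr => u _.
by rewrite -big_mkcondr /= big_const_seq iter_addr_0.
Qed.

Variable chi : 'F_p -> C.
Hypotheses (chi0 : chi 0 = 0) (chi_sum : \sum_x chi x = 0).
Hypothesis chi_norm : forall x, x != 0 -> normc (chi x) = 1.

(* Since chi has mean 0, its sum is also that of chi u * (p.-1 * cnt u - D); as D
   bounds each p.-1 * cnt u from above and the total count is known, no lower
   bound for cnt u is needed. *)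
Lemma pure_sum_bound :
  normc (\sum_(z <- ffix n) chi (rho (g.[z] ^+ e)))
    <= ((6 * p.-1 * m + 2) * p ^ h + m)%:R.
Proof.
have d_gt0 : (0 < p.-1)%N by lia.
have e_gt0 : (0 < e)%N.
  have := norm_exponent tE; rewrite -/e -/n.
  have : (1 < p ^ n)%N by rewrite -{1}(expn0 p) ltn_exp2l.
  by case: e => //; rewrite muln0; lia.
have [g1 gE g1b] := simple_root_factor gb gb'.
set D := (p ^ n + (6 * p.-1 * m + 2) * p ^ h)%N.
have cnt_le u : (p.-1 * cnt u <= D)%N.
  rewrite /cnt -size_filter; apply: (@stepanov_bound K p h p.-1 t m g g1 b (io u)) => //.
  - exact: (pcharK p_pr io).
  - by rewrite filter_uniq // (ffix_uniq p_pr io).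
  move=> x; rewrite mem_filter => /andP[/andP[gx /eqP gu] xn]; split=> //.
  by apply/eqP; rewrite -(mem_ffix p_pr).
have sum_cnt : (p ^ n <= \sum_(u : 'F_p | u != 0%R) cnt u + m)%N.
  rewrite -(size_ffix p_pr K n_gt0) -(count_predC (fun z => g.[z] != 0)) leq_add //.
    rewrite -sum1_count (@sum_by_value nat (fun=> 1%N)).
    by apply/eq_leq/eq_bigr => u _; exact: natn.
  rewrite -ltnS -size_g -size_filter; apply: max_poly_roots.
  - by rewrite -size_poly_gt0 size_g.
  - by apply/allP => z; rewrite mem_filter /= negbK => /andP[].
  - by rewrite filter_uniq // (ffix_uniq p_pr io).
have SE : p.-1%:R * \sum_(z <- ffix n) chi (rho (g.[z] ^+ e))
    = \sum_(u | u != 0) chi u * ((p.-1 * cnt u)%:R - D%:R).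
  under [RHS]eq_bigr => u _ do rewrite mulrBr natrM mulrCA mulr_natr.
  rewrite sumrB -mulr_suml [X in _ - X * _](_ : _ = 0); last first.
    by move: chi_sum; rewrite (bigD1 0) //= chi0 add0r.
  rewrite mul0r subr0 -mulr_sumr; congr (_ * _); rewrite -sum_by_value.
  rewrite [LHS](bigID (fun z => g.[z] != 0)) /= [X in _ + X]big1 ?addr0 //.
  by move=> z; rewrite negbK => /eqP->; rewrite expr0n (gtn_eqF e_gt0) rho0.
have d0 : 0 < p.-1%:R :> R by rewrite ltr0n.
rewrite -(ler_pM2l d0).
rewrite -{1}(normc_nat R p.-1) -normcM SE; apply: le_trans (normc_sum _ _ _) _.
have -> : \sum_(u | u != 0) normc (chi u * ((p.-1 * cnt u)%:R - D%:R)) =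
    \sum_(u : 'F_p | u != 0) (D - p.-1 * cnt u)%:R.
  apply: eq_bigr => u u0; rewrite normcM chi_norm // mul1r -opprB normcN.
  by rewrite -natrB ?cnt_le // normc_nat.
rewrite -natr_sum -natrM ler_nat -(leq_add2r (p.-1 * \sum_(u : 'F_p | u != 0%R) cnt u)%N).
rewrite [X in (_ + X <= _)%N]big_distrr /= -big_split /=.
under eq_bigr => u _ do rewrite subnK ?cnt_le //.
rewrite sum_nat_const (_ : #|_| = p.-1); last first.
  by have := cardC1 (0 : 'F_p); rewrite card_Fp.
by rewrite -mulnDr leq_pmul2l // /D addnC -addnA leq_add2l [(m + _)%N]addnC.
Qed.

End PureSum.

End ExponentialSums.

Section Weil.

Variables (p : nat) (p_pr : prime p) (R : realType).
Local Notation C := R[i].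
Variables (chi psi : 'F_p -> C) (B : seq 'F_p).
Hypotheses (chi0 : chi 0 = 0) (chi1 : chi 1 = 1).
Hypothesis chiM : {morph chi : x y / x * y}.
Hypothesis chi_sum : \sum_x chi x = 0.
Hypothesis chi_norm : forall x, x != 0 -> normc (chi x) = 1.
Hypothesis psi0 : psi 0 = 1.
Hypothesis psiD : {morph psi : x y / x + y >-> x * y}.
Hypothesis psi_norm : forall x, normc (psi x) = 1.
Hypotheses (uB : uniq B) (B0 : B != [::]).

Let p_gt0 : (0 < p)%N := prime_gt0 p_pr.
Let p_gt1 : (1 < p)%N := prime_gt1 p_pr.

Section Closure.

Variables (K : closedFieldType) (io : {rmorphism 'F_p -> K}).
Local Notation ffix := (ffix p K).
Local Notation rho := (rho io).

Let f : {poly K} := \prod_(b <- B) ((io b)%:P - 'X).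

Lemma trace_rho n x : (0 < n)%N -> x \in ffix n -> io (rho (trace p n x)) = trace p n x.
Proof.
move=> n0; rewrite (mem_ffix p_pr) // => /eqP xn; apply: (rhoK p_pr).
have := trace_artin_schreier p_pr io n x; rewrite xn subrr (traceB p_pr io).
move/eqP; rewrite subr_eq0 => /eqP E; rewrite -[RHS]E.
rewrite /trace -(pFrobenius_autE (pcharK p_pr io)) rmorph_sum /=.
by apply: eq_bigr => i _; rewrite pFrobenius_autE exprAC.
Qed.

(** The value at b of the orbit polynomial is the norm (b - x)^e, as e = 1 + p + ... + p^(n-1), and
    its coefficient of degree n - 1 is minus the trace of x. *)
Lemma polychar_orbpoly n e x : (0 < n)%N -> x \in ffix n ->
    (p.-1 * e = (p ^ n).-1)%N ->
  polychar chi psi B n (orbpolyF io n x)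
    = chi (rho (f.[x] ^+ e)) * psi (rho (trace p n x)).
Proof.
move=> n0 xn eE; have oE := orbpolyK p_pr io xn n0.
have eS : e = (\sum_(i < n) p ^ i)%N.
  by apply/eqP; rewrite -(eqn_pmul2l (_ : 0 < p.-1)%N) ?eE ?predn_exp //; lia.
rewrite /polychar -(big_morph chi chiM chi1); congr (chi _ * psi _).
  rewrite -[LHS](ioK io) rmorph_prod /f horner_prod -prodrXl; congr rho.
  apply: eq_bigr => b _; rewrite -horner_map oE /orbpoly horner_prod !hornerE eS.
  rewrite expr_sum; apply: eq_bigr => i _.
  rewrite hornerXsubC (pexpD p_pr io) (pexpN p_pr io) -rmorphXn /=.
  congr (io _ - _); elim: (nat_of_ord i) => [|k IH]; first by rewrite expr1.
  by rewrite expnSr exprM -IH; have := expf_card b; rewrite card_Fp.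
rewrite -[LHS](ioK io) rmorphN coefXM gtn_eqF //= -coef_map oE /orbpoly.
congr rho; rewrite -(big_mkord xpredT (fun i => 'X - (x ^+ (p ^ i))%:P)).
rewrite -(big_map (fun i => x ^+ (p ^ i)) xpredT (fun y => 'X - y%:P)).
have {1}-> : n.-1 = (size [seq x ^+ (p ^ i) | i <- index_iota 0 n]).-1.
  by rewrite size_map size_iota subn0.
rewrite coefPn_prod_XsubC; last by rewrite size_map size_iota subn0 -lt0n.
by rewrite opprK big_map big_mkord.
Qed.

Lemma ffix_prod n x : (0 < n)%N -> x \in ffix n -> f.[x] \in ffix n.
Proof.
move=> n0 xn; rewrite /f horner_prod.
apply: (big_ind (fun y => y \in ffix n)) => [|a b|b _].
- by rewrite -(rmorph1 io) (ffix_io p_pr).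
- exact: (ffixM p_pr).
by rewrite !hornerE (ffixB p_pr io) ?(ffix_io p_pr).
Qed.

Let m := (p * size B)%N.

(** The polynomial z^p - z + c has derivative -1, so composing f with it keeps the roots simple and
    multiplies the degree by p; [pure_sum_bound] applies to the composite. *)
Lemma twisted_sum_bound h c (e := ((p ^ h).-1 %/ p.-1 * (p ^ h).+1)%N) :
    (0 < h)%N -> c \in ffix (2 * h) ->
  normc (\sum_(z <- ffix (2 * h)) chi (rho (f.[z ^+ p - z + c] ^+ e)))
    <= ((6 * p.-1 * m + 2) * p ^ h + m)%:R.
Proof.
move=> h0 cn; have n0 : (0 < 2 * h)%N by rewrite muln_gt0.
pose tau : {poly K} := 'X^p - 'X + c%:P.
have tauE z : tau.[z] = z ^+ p - z + c by rewrite /tau !hornerE.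
have size_tau : size tau = p.+1.
  rewrite /tau -addrA size_polyDl size_polyXn // ltnS.
  rewrite addrC -opprB size_polyN size_polyDl size_polyX ?size_polyN //.
  by rewrite ltnS size_polyC_leq1.
have B_gt0 : (0 < size B)%N by rewrite lt0n size_eq0.
have fE : f = (- 1) ^+ size B *: \prod_(b <- B) ('X - (io b)%:P).
  rewrite /f; elim: (B) => [|b s IH]; first by rewrite !big_nil scale1r.
  by rewrite !big_cons IH exprS mulN1r scaleNr -scalerAr -scalerN -mulNr opprB.
have sg0 : (- 1) ^+ size B != 0 :> K by rewrite signr_eq0.
have size_f : size f = (size B).+1 by rewrite fE size_scale // size_prod_XsubC.
pose g := f \Po tau.
have gE z : g.[z] = f.[z ^+ p - z + c] by rewrite horner_comp tauE.
have size_g : size g = m.+1.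
  have := size_comp_poly f tau; rewrite size_f size_tau /= -/g.
  case: (size g) => [|k /= ->]; rewrite /m mulnC //.
  by case: (size B) B_gt0 p_gt0 => //; lia.
have [b1 b1B] : exists b, b \in B by case: (B) B0 => // b s _; exists b; rewrite mem_head.
have [z1 z1E] : exists z, tau.[z] = io b1.
  have : size (tau - (io b1)%:P) != 1%N.
    rewrite size_polyDl ?size_tau ?eqSS -?lt0n // size_polyN.
    by rewrite (leq_ltn_trans (size_polyC_leq1 _)).
  case/closed_rootP=> z; rewrite rootE !hornerE subr_eq0 => /eqP E.
  by exists z; rewrite tauE.
have root_f : root f (io b1).
  by rewrite /f rootE horner_prod (big_rem _ b1B) /= !hornerE subrr mul0r.
have f'b1 : ~~ root f^`() (io b1).
  rewrite /f (big_rem _ b1B) derivM derivB derivX derivC rootE.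
  rewrite sub0r mulN1r hornerD hornerN [X in _ + X]hornerM hornerD hornerN hornerC.
  rewrite hornerX subrr mul0r addr0 oppr_eq0 horner_prod.
  rewrite prodf_seq_neq0; apply/allP => b bB /=.
  rewrite !hornerE subr_eq0 (inj_eq (fmorph_inj io)).
  by apply: contraTneq bB => ->; rewrite mem_rem_uniqF.
have gz1 : root g z1 by rewrite rootE horner_comp z1E -rootE.
have gz1' : ~~ root g^`() z1.
  rewrite rootE deriv_comp hornerM horner_comp z1E mulf_neq0 // /tau.
  rewrite derivD derivB derivXn derivX derivC addr0 -mulr_natr.
  have -> : p%:R = 0 :> {poly K} by apply: pcharf0; rewrite pchar_poly (pcharK p_pr io).
  by rewrite !hornerE ?sub0r oppr_eq0 oner_eq0.
under eq_bigr => z _ do rewrite -gE.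
have tE : (p.-1 * ((p ^ h).-1 %/ p.-1) = (p ^ h).-1)%N.
  by rewrite mulnC divnK // predn_exp dvdn_mulr.
have g_ffix z : z \in ffix (2 * h) -> g.[z] \in ffix (2 * h).
  by move=> zn; rewrite gE ffix_prod // (ffixD p_pr io) ?(ffixB p_pr io) ?(ffixX p_pr).
exact: (pure_sum_bound p_pr io h0 tE size_g gz1 gz1' g_ffix chi0 chi_sum chi_norm).
Qed.

(** When split by the value of the trace, the sum over each nonempty fibre is 1/p times a twisted
    sum, and there are p fibres. The constant depends on p but not on h, as [power_sum_radius]
    requires. *)
Lemma psum_bound h : (0 < h)%N ->
  normc (psum io chi psi B (2 * h))
    <= ((6 * p.-1 * m + 2) + m)%:R * p%:R ^+ h.
Proof.
move=> h0; set bd := (6 * p.-1 * m + 2)%N.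
have n0 : (0 < 2 * h)%N by rewrite muln_gt0.
set n := (2 * h)%N in n0 *; pose e := ((p ^ h).-1 %/ p.-1 * (p ^ h).+1)%N.
have tE : (p.-1 * ((p ^ h).-1 %/ p.-1) = (p ^ h).-1)%N.
  by rewrite mulnC divnK // predn_exp dvdn_mulr.
have eE := norm_exponent p_pr tE; rewrite -/e -/n in eE.
pose T x := chi (rho (f.[x] ^+ e)).
have psumE : psum io chi psi B n = \sum_(v : 'F_p) psi v *
    \sum_(x <- ffix n | rho (trace p n x) == v) T x.
  rewrite /psum; under [RHS]eq_bigr => v _ do rewrite mulr_sumr big_mkcond.
  rewrite exchange_big /= big_seq [RHS]big_seq; apply: eq_bigr => x xn.
  rewrite (polychar_orbpoly n0 xn eE) -big_mkcond /=.
  rewrite (big_pred1 (rho (trace p n x))) => [|v]; last by rewrite /= eq_sym.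
  by rewrite mulrC.
have fiber v : p%:R * normc (\sum_(x <- ffix n | rho (trace p n x) == v) T x)
    <= (bd * p ^ h + m)%:R.
  have [/hasP[c cn /eqP vE]|/hasPn no] :=
    boolP (has (fun x => rho (trace p n x) == v) (ffix n)).
    rewrite -(normc_nat R p) -normcM big_seq_cond.
    rewrite (eq_bigl (fun x => (x \in ffix n) && (trace p n x == trace p n c))).
      by rewrite -big_seq_cond -(artin_schreier_sum p_pr io) // twisted_sum_bound.
    move=> x /=; apply: andb_id2l => xn.
    by rewrite -vE -(inj_eq (fmorph_inj io)) !trace_rho.
  rewrite big_seq_cond big1 ?normc0 ?mulr0 ?ler0n // => x /andP[/no/negbTE->].
  by [].
have p0 : 0 < p%:R :> R by rewrite ltr0n.
rewrite -(ler_pM2l p0) psumE.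
apply: (@le_trans _ _ (\sum_(v : 'F_p) (bd * p ^ h + m)%:R)).
  apply: le_trans (ler_wpM2l (ltW p0) (normc_sum _ _ _)) _.
  rewrite mulr_sumr; apply: ler_sum => v _.
  by rewrite normcM psi_norm mul1r.
rewrite sumr_const card_Fp // -[leLHS]mulr_natl ler_pM2l // -natrX -natrM ler_nat.
by rewrite mulnDl leq_add2l leq_pmulr // expn_gt0 p_gt0.
Qed.

End Closure.

(** The even power sums are power sums of the squares w^2, so [power_sum_radius] gives |w|^2 <= p.
    The sum in question is the first power sum up to sign, and there are at most [size B] roots
    because the later coefficients of the L-function vanish. *)
Theorem weil_bound :
  normc (\sum_x (\prod_(b <- B) chi (b - x)) * psi x)
    <= (size B)%:R * Num.sqrt p%:R.
Proof.
have [K [io _]] := countable_algebraic_closure 'F_p.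
have p0 : p%:R != 0 :> C by rewrite pnatr_eq0 -lt0n.
have charC : [pchar C] =i pred0 by exact: pchar_num.
have [n|n|s size_s sE] := @power_sums_of_recurrence C (csum chi psi B)
    (psum io chi psi B) (size B) charC (csum0 B chi1 psi0).
- exact: (csum_eq0 p_pr psi chi_sum p0 uB B0).
- rewrite (csum_rec p_pr io B chiM psiD p0) big_add1 /= big_mkord.
  by apply: eq_bigr => i _; rewrite subSS.
have s_bound w : w \in s -> normc w <= Num.sqrt p%:R.
  move=> ws; rewrite -ler_sqr ?nnegrE ?normc_ge0 ?sqrtr_ge0 //.
  rewrite sqr_sqrtr ?ler0n // -normcX.
  pose Bd : R := ((6 * p.-1 * (p * size B) + 2) + p * size B)%:R.
  apply: (@power_sum_radius R [seq z ^+ 2 | z <- s] Bd); last exact: map_f.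
    by rewrite ltr0n.
  move=> h; rewrite big_map; have := psum_bound io (ltn0Sn h).
  rewrite mulnS add2n sE normcN; congr (normc _ <= _).
  by apply: eq_bigr => z _; rewrite -exprM mulnS add2n.
have -> : \sum_x (\prod_(b <- B) chi (b - x)) * psi x = psum io chi psi B 1.
  rewrite /psum (perm_big [seq io a | a <- enum 'F_p]) /=; last first.
    apply: uniq_perm; rewrite ?(ffix_uniq p_pr io) //.
      by rewrite map_inj_uniq ?enum_uniq //; apply: fmorph_inj.
    move=> x; rewrite (mem_ffix p_pr) // expn1; apply/eqP/mapP => [xp|[a _ ->]].
      by exists (rho io x); rewrite ?mem_enum // (rhoK p_pr io xp).
    by rewrite -rmorphXn /=; have := expf_card a; rewrite card_Fp // => ->.
  rewrite big_map big_enum /=; apply: eq_bigr => a _.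
  have -> : orbpolyF io 1 (io a) = 'X - a%:P.
    apply: (map_poly_inj io); rewrite (orbpolyK p_pr) ?(ffix_io p_pr) //.
    by rewrite /orbpoly big_ord_recl big_ord0 mulr1 expr1 rmorphB /= map_polyX map_polyC.
  rewrite /polychar; congr (_ * psi _).
    by apply: eq_bigr => b _; rewrite hornerXsubC.
  by rewrite coefXM /= coefB coefX coefC /= sub0r opprK.
rewrite sE normcN; apply: le_trans (normc_sum _ _ _) _.
apply: (@le_trans _ _ (\sum_(w <- s) Num.sqrt p%:R)).
  by rewrite big_seq [leRHS]big_seq; apply: ler_sum => w ws; rewrite expr1 s_bound.
rewrite big_const_seq iter_addr_0 count_predT -[leLHS]mulr_natl.
rewrite ler_wpM2r ?sqrtr_ge0 //.
by rewrite ler_nat.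
Qed.

End Weil.

(** * Sums of chi(n!) *)

Section Characters.

Variable R : realType.
Local Notation C := R[i].

Lemma prim_root_exists n : (0 < n)%N -> exists z : C, n.-primitive_root z.
Proof.
move=> n_gt0; have [r rE] := closed_field_poly_normal ('X^n - 1 : {poly C}).
rewrite lead_coefXnsubC // scale1r in rE.
have size_r : size r = n.
  by apply/eqP; rewrite -eqSS -(size_prod_XsubC r id) -rE size_XnsubC.
have /hasP[z _ zP] : has n.-primitive_root r; last by exists z.
apply: has_prim_root => //.
- apply/allP => z; rewrite -root_prod_XsubC -rE unity_rootE.
  by rewrite rootE !hornerE subr_eq0.
- by rewrite -separable_prod_XsubC -rE separable_Xn_sub_1 // pnatr_eq0 -lt0n.
- by rewrite size_r.
Qed.

Lemma normc_root1 n (z : C) : (0 < n)%N -> z ^+ n = 1 -> normc z = 1.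
Proof.
move=> n0 zn; apply/eqP; rewrite -(@pexpr_eq1 _ _ n) ?normc_ge0 //.
by rewrite -normcX zn normc1.
Qed.

Lemma sum_prim_root n (z : C) k : n.-primitive_root z ->
  \sum_(j < n) z ^+ (j * k) = (if (n %| k)%N then n%:R else 0).
Proof.
move=> zP; have zn := prim_expr_order zP.
case: ifP => [/dvdnP[q ->]|nk].
  rewrite (eq_bigr (fun=> 1)) => [|j _]; first by rewrite sumr_const card_ord.
  by rewrite mulnA exprM exprAC zn expr1n.
have y1 : z ^+ k - 1 != 0.
  by rewrite subr_eq0 -[1](expr0 z) (eq_prim_root_expr zP) mod0n -/(dvdn _ _) nk.
apply: (mulfI y1); rewrite mulr0; transitivity ((z ^+ k) ^+ n - 1).
  rewrite [RHS]subrX1; congr (_ * _); apply: eq_bigr => j _.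
  by rewrite mulnC exprM.
by rewrite exprAC zn expr1n subrr.
Qed.

Variables (p : nat) (p_pr : prime p).

(** For a generator g of F_p^* and a primitive root of unity w of order p - 1, [X j] sends g^i to
    w^(i j); the index 0 is the principal character. *)
Lemma multiplicative_characters : exists X : 'I_p.-1 -> 'F_p -> C,
  [/\ forall j, X j 0 = 0,
      forall j, X j 1 = 1,
      forall j, {morph X j : x y / x * y},
      forall j x, x != 0 -> normc (X j x) = 1 &
      [/\ forall x, x != 0 -> \sum_j X j x = (if x == 1 then p.-1%:R else 0),
          forall j : 'I_p.-1, (j != 0 :> nat)%N -> \sum_x X j x = 0 &
          forall (j : 'I_p.-1) x, x != 0 -> j = 0%N :> nat -> X j x = 1]].
Proof.
have p1_gt0 : (0 < p.-1)%N by have := prime_gt1 p_pr; lia.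
have [w wP] := prim_root_exists p1_gt0.
have [g gP] : exists g : 'F_p, p.-1.-primitive_root g.
  have /hasP[g _ gP] : has (p.-1).-primitive_root [seq x <- enum 'F_p | x != 0].
    apply: has_prim_root => //.
    - apply/allP => x; rewrite mem_filter => /andP[x0 _].
      rewrite unity_rootE; apply/eqP/(mulfI x0).
      rewrite -exprS prednK ?prime_gt0 // mulr1.
      by have := expf_card x; rewrite card_Fp.
    - by rewrite filter_uniq ?enum_uniq.
    by rewrite -rem_filter ?enum_uniq // size_rem ?mem_enum // -cardE card_Fp.
  by exists g.
have g0 : g != 0.
  apply/eqP => g0; have := prim_expr_order gP.
  by rewrite g0 expr0n gtn_eqF // => /esym/eqP; rewrite oner_eq0.
(* Discrete logarithm to the base g; the default is reached at x = 0 only. *)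
pose dlog (x : 'F_p) : nat := odflt (Ordinal p1_gt0) [pick i : 'I_p.-1 | g ^+ i == x].
have dlogE x : x != 0 -> g ^+ dlog x = x.
  move=> x0; rewrite /dlog; case: pickP => [i /eqP //|no].
  have xp : x ^+ p.-1 = 1.
    apply/(mulfI x0); rewrite -exprS prednK ?prime_gt0 // mulr1.
    by have := expf_card x; rewrite card_Fp.
  by have [i xi] := prim_rootP gP xp; have := no i; rewrite -xi eqxx.
pose X (j : 'I_p.-1) x : C := if x == 0 then 0 else w ^+ (j * dlog x).
have w_dlog k l j : (k = l %[mod p.-1])%N -> w ^+ (j * k) = w ^+ (j * l).
  by move=> kl; rewrite ![(j * _)%N]mulnC !exprM; congr (_ ^+ _); apply/eqP;
    rewrite (eq_prim_root_expr wP) kl.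
have dlog_mod x k : x = g ^+ k -> (dlog x = k %[mod p.-1])%N.
  move=> xE; apply/eqP; rewrite -(eq_prim_root_expr gP) dlogE -?xE //.
  by rewrite xE expf_neq0.
have X1 j : X j 1 = 1.
  rewrite /X oner_eq0 (w_dlog _ 0%N) ?muln0 //.
  by apply: dlog_mod; rewrite expr0.
have XM j : {morph X j : x y / x * y}.
  move=> x y; rewrite /X mulf_eq0; case: eqVneq => [_|x0]; first by rewrite mul0r.
  case: eqVneq => [_|y0] /=; first by rewrite mulr0.
  rewrite -exprD -mulnDr; apply: w_dlog; apply: dlog_mod.
  by rewrite exprD !dlogE.
have Xn j x : x != 0 -> normc (X j x) = 1.
  move=> x0; rewrite /X (negbTE x0) normcX.
  by rewrite (normc_root1 p1_gt0 (prim_expr_order wP)) expr1n.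
exists X; split=> //.
split=> [x x0|j j0|j x x0 j0].
- rewrite /X (negbTE x0) (sum_prim_root _ wP); congr (if _ then _ else _).
  by rewrite -{2}(dlogE _ x0) -(expr0 g) (eq_prim_root_expr gP) mod0n.
- have Xg : X j g != 1.
    rewrite /X (negbTE g0) (w_dlog _ 1%N) ?muln1.
      rewrite -(expr0 w) (eq_prim_root_expr wP) mod0n.
      by rewrite modn_small ?ltn_ord.
    exact: dlog_mod.
  have E : \sum_x X j x = X j g * \sum_x X j x.
    rewrite mulr_sumr [LHS](reindex_inj (mulfI g0)) /=.
    by apply: eq_bigr => x _; rewrite XM.
  apply/eqP; move/eqP: E; rewrite -subr_eq0 -{1}[\sum_x _]mul1r -mulrBl.
  by rewrite mulf_eq0 subr_eq0 eq_sym (negbTE Xg).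
by rewrite /X (negbTE x0) j0 mul0n.
Qed.

Lemma additive_characters : exists Y : 'F_p -> 'F_p -> C,
  [/\ forall a, Y a 0 = 1,
      forall a, {morph Y a : x y / x + y >-> x * y},
      forall a x, normc (Y a x) = 1 &
      forall x, \sum_a Y a x = (if x == 0 then p%:R else 0)].
Proof.
have p0 := prime_gt0 p_pr.
have [w wP] := prim_root_exists p0.
have wn : normc w = 1 := normc_root1 p0 (prim_expr_order wP).
have val_mod (x : 'F_p) k : x = k%:R -> ((x : nat) = k %[mod p])%N.
  by move=> ->; rewrite val_Fp_nat // modn_mod.
have w_mod k l a : (k = l %[mod p])%N -> w ^+ (a * k) = w ^+ (a * l).
  by move=> kl; rewrite ![(a * _)%N]mulnC !exprM; congr (_ ^+ _); apply/eqP;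
    rewrite (eq_prim_root_expr wP) kl.
exists (fun a x => w ^+ (a * x)); split.
- by move=> a; rewrite muln0 expr0.
- move=> a x y; rewrite -exprD -mulnDr; apply: w_mod; apply: val_mod.
  by rewrite natrD !natr_Zp.
- by move=> a x; rewrite normcX wn expr1n.
move=> x.
have -> : (x == 0) = (p %| x)%N.
  by rewrite (dvdn_pcharf (pchar_Fp p_pr)) natr_Zp.
rewrite -(sum_prim_root x wP).
(* 'F_p is an ordinal type whose bound is equal to p by a proof only, not by computation. *)
have cast q : q = p -> \sum_(j < q) w ^+ (j * x) = \sum_(j < p) w ^+ (j * x).
  by move=> ->.
exact: cast (Fp_cast p_pr).
Qed.

End Characters.

Section ComplexNorm.

Variable R : realType.
Local Notation C := R[i].

Lemma normc_sqr (z : C) : (normc z ^+ 2)%:C%C = z * conjc z.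
Proof.
case: z => a b; rewrite /normc sqr_sqrtr ?addr_ge0 ?sqr_ge0 //.
by apply/eqP; rewrite eq_complex /=; apply/andP; split; apply/eqP; ring.
Qed.

Lemma normc_conj (z : C) : normc (conjc z) = normc z.
Proof. by case: z => a b; rewrite /normc /= sqrrN. Qed.

Lemma normc_real (x : R) : normc (x%:C%C) = `|x|.
Proof. by rewrite /normc /= expr0n addr0 sqrtr_sqr. Qed.

End ComplexNorm.

(** * Completion of sums weighted by differences *)

Section Differences.

Variables (p : nat) (p_pr : prime p).

Lemma count_residue (c : 'F_p) L : (L <= p + p)%N ->
  (\sum_(i < L) (i%:R == c)%R <= 2)%N.
Proof.
move=> leL.
have le1 : (\sum_(i < p) (i%:R == c)%R <= 1)%N.
  have -> : (\sum_(i < p) (i%:R == c)%R = #|[pred i : 'I_p | i%:R == c]|)%N.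
    rewrite -sum1_card [RHS]big_mkcond; apply: eq_bigr => i _.
    by rewrite inE; case: (_ == _).
  apply/card_le1_eqP => i j; rewrite !inE => /eqP<- /eqP/(congr1 val) /= e.
  apply/val_inj; move: e; rewrite !val_Fp_nat // !modn_small //.
apply: (@leq_trans (\sum_(i < p + p) (i%:R == c)%R)).
  by rewrite (big_ord_widen _ (fun i => (i%:R == c)%R : nat) leL) [leqLHS]big_mkcond;
    apply: leq_sum => i _; case: ifP.
rewrite big_split_ord /= -[2%N]/(1 + 1)%N leq_add //.
rewrite (eq_bigr (fun i : 'I_p => (i%:R == c)%R : nat)) // => i _.
by rewrite natrD pchar_Fp_0 // add0r.
Qed.

Lemma count_difference (c : 'F_p) L : (L <= p + p)%N ->
  (\sum_(i < L) \sum_(j < L) (i%:R - j%:R == c)%R <= 2 * L)%N.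
Proof.
move=> leL; rewrite exchange_big /= mulnC -[X in (X * 2)%N]card_ord -sum_nat_const.
apply: leq_sum => j _; apply: leq_trans (count_residue (c + j%:R) leL).
by apply/eq_leq/eq_bigr => i _; rewrite subr_eq.
Qed.

Variable R : realType.
Local Notation C := R[i].

(* The additive Fourier coefficients of the difference weight are squares
   |T a|^2, so their total mass is given by the count of the diagonal i = j. *)
Lemma difference_sum_bound (Q : 'F_p -> C) (M : R) (x0 : 'F_p) L :
    (L <= p + p)%N ->
    (forall psi : 'F_p -> C, psi 0 = 1 -> {morph psi : x y / x + y >-> x * y} ->
       (forall x, normc (psi x) = 1) -> normc (\sum_x Q x * psi x) <= M) ->
  normc (\sum_(i < L) \sum_(j < L) Q (x0 + (i%:R - j%:R))) <= M * (2 * L)%:R.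
Proof.
move=> leL QM; have [Y [Y0 YD Yn Ysum]] := additive_characters R p_pr.
have p0 : 0 < p%:R :> R by rewrite ltr0n prime_gt0.
have YN a x : Y a (- x) = conjc (Y a x).
  have YYN : Y a x * Y a (- x) = 1 by rewrite -YD subrr.
  apply: (mulfI (_ : Y a x != 0)).
    by apply: contraTneq (oner_neq0 C) => y0; rewrite -YYN y0 mul0r eqxx.
  by rewrite YYN -normc_sqr Yn expr1n.
have invQ y : p%:R * Q y = \sum_a (\sum_x Q x * Y a x) * Y a (- y).
  under eq_bigr => a _ do rewrite mulr_suml.
  rewrite exchange_big /= (bigD1 y) //= [X in _ = _ + X]big1 => [|x xy].
    rewrite addr0; under eq_bigr => a _ do rewrite -mulrA -YD subrr.
    by rewrite -mulr_sumr Ysum eqxx mulrC.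
  under eq_bigr => a _ do rewrite -mulrA -YD.
  by rewrite -mulr_sumr Ysum subr_eq0 (negbTE xy) mulr0.
pose T a := \sum_(j < L) Y a j%:R.
have sumT : \sum_a normc (T a) ^+ 2 <= p%:R * (2 * L)%:R.
  suff -> : \sum_a normc (T a) ^+ 2 =
      p%:R * (\sum_(i < L) \sum_(j < L) (i%:R - j%:R == 0 :> 'F_p)%R)%N%:R.
    by rewrite ler_pM2l // ler_nat count_difference.
  apply: complexI; rewrite rmorph_sum rmorphM !rmorph_nat /=.
  under eq_bigr => a _ do
    rewrite normc_sqr /T rmorph_sum mulr_suml.
  rewrite exchange_big natr_sum mulr_sumr; apply: eq_bigr => i _.
  under eq_bigr => a _ do rewrite mulr_sumr.
  rewrite exchange_big natr_sum mulr_sumr; apply: eq_bigr => j _.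
  under eq_bigr => a _ do rewrite -[X in _ * X]/(conjc _) -YN -YD.
  by rewrite Ysum; case: eqP; rewrite ?mulr1 ?mulr0.
rewrite -(ler_pM2l p0) -{1}(normc_nat R p) -normcM.
have -> : p%:R * (\sum_(i < L) \sum_(j < L) Q (x0 + (i%:R - j%:R))) =
    \sum_a (\sum_x Q x * Y a x) * (Y a (- x0) * (conjc (T a) * T a)).
  rewrite mulr_sumr; under eq_bigr => i _ do rewrite mulr_sumr.
  under eq_bigr => i _ do under eq_bigr => j _ do rewrite invQ.
  under eq_bigr => i _ do rewrite exchange_big /=.
  rewrite exchange_big /=; apply: eq_bigr => a _.
  rewrite /T rmorph_sum /= [X in Y a _ * X]mulr_suml !mulr_sumr.
  apply: eq_bigr => i _; rewrite !mulr_sumr; apply: eq_bigr => j _.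
  by rewrite -YN -!YD; congr (_ * Y a _); ring.
apply: le_trans (normc_sum _ _ _) _.
apply: (@le_trans _ _ (\sum_a M * normc (T a) ^+ 2)).
  apply: ler_sum => a _; rewrite !normcM Yn mul1r normc_conj -expr2.
  by rewrite ler_wpM2r ?sqr_ge0 // QM.
rewrite -mulr_sumr mulrCA ler_wpM2l //.
apply: le_trans (normc_ge0 _) (QM (Y 0) _ _ _) => //.
Qed.

End Differences.

(** Expansion of the nonnegative double sum of the (a i - a j)^2. *)
Lemma sqr_sum_le (F : realFieldType) (I : finType) (P : pred I) (a : I -> F) :
  (\sum_(i | P i) a i) ^+ 2 <= #|P|%:R * \sum_(i | P i) a i ^+ 2.
Proof.
have : 0 <= \sum_(i | P i) \sum_(j | P j) (a i - a j) ^+ 2.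
  by apply: sumr_ge0 => i _; apply: sumr_ge0 => j _; exact: sqr_ge0.
set S1 := \sum_(i | P i) a i; set S2 := \sum_(i | P i) a i ^+ 2.
have -> : \sum_(i | P i) \sum_(j | P j) (a i - a j) ^+ 2
    = 2 * (#|P|%:R * S2 - S1 ^+ 2).
  transitivity (\sum_(i | P i) (#|P|%:R * a i ^+ 2 + S2 - 2 * (S1 * a i))).
    apply: eq_bigr => i _.
    rewrite (eq_bigr (fun j => a i ^+ 2 + a j ^+ 2 - 2 * (a i * a j))); last first.
      by move=> j _; ring.
    rewrite sumrB big_split /= sumr_const -!mulr_sumr -[a i ^+ 2 *+ _]mulr_natl.
    by rewrite -/S1 -/S2 [S1 * _]mulrC.
  rewrite sumrB big_split /= sumr_const -!mulr_sumr -/S1 -/S2.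
  by rewrite -[S2 *+ _]mulr_natl; ring.
by rewrite pmulr_rge0 // subr_ge0.
Qed.

(** * Shifting and mean squares of products of consecutive values *)

Section FactorialSum.

Variables (p : nat) (p_pr : prime p) (R : realType).
Local Notation C := R[i].
Variable chi : 'F_p -> C.
Hypotheses (chi0 : chi 0 = 0) (chi1 : chi 1 = 1).
Hypothesis chiM : {morph chi : x y / x * y}.
Hypothesis chi_sum : \sum_x chi x = 0.
Hypothesis chi_norm : forall x, x != 0 -> normc (chi x) = 1.

Let p_gt0 : (0 < p)%N := prime_gt0 p_pr.

Lemma chi_le1 x : normc (chi x) <= 1.
Proof. by have [->|/chi_norm->//] := eqVneq x 0; rewrite chi0 normc0 ler01. Qed.

Definition rising k (x : 'F_p) : C := \prod_(0 <= i < k) chi (x + i.+1%:R).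

Lemma normc_prod (I : Type) (r : seq I) (F : I -> C) :
  normc (\prod_(i <- r) F i) = \prod_(i <- r) normc (F i).
Proof. by elim/big_rec2: _ => [|i y1 y2 _ <-]; rewrite ?normc1 ?normcM. Qed.

Lemma normc_prod_chi (s : seq nat) (F : nat -> 'F_p) :
  normc (\prod_(i <- s) chi (F i)) <= 1.
Proof.
rewrite normc_prod; elim: s => [|i s IH]; rewrite ?big_nil // big_cons.
by rewrite mulr_ile1 ?chi_le1 ?normc_ge0 // prodr_ge0 // => j _; apply: normc_ge0.
Qed.

Lemma rising_le1 k x : normc (rising k x) <= 1.
Proof. exact: normc_prod_chi. Qed.

(* |rising l x| is 1, except at the zeros of its factors. *)
Lemma rising_correlation k l x (Q := \prod_(l <= i < k) chi (x + i.+1%:R)) :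
    (l <= k)%N ->
  normc (rising k x * conjc (rising l x) - Q)
    <= \sum_(i < l) (x == - i.+1%:R)%:R.
Proof.
move=> le_lk.
have -> : rising k x * conjc (rising l x) - Q
    = ((normc (rising l x) ^+ 2)%:C%C - 1) * Q.
  rewrite normc_sqr {1}/rising (@big_cat_nat _ _ _ l) //= -/(rising l x) -/Q.
  by ring.
rewrite -(rmorph1 (real_complex R)) -rmorphB normcM normc_real.
apply: (@le_trans _ _ `|normc (rising l x) ^+ 2 - 1|).
  by rewrite ler_piMr ?normr_ge0 // normc_prod_chi.
have [/existsP[i xi]|no] := boolP [exists i : 'I_l, x == - i.+1%:R].
  apply: (@le_trans _ _ 1).
    rewrite ler_norml; have := rising_le1 l x; have := normc_ge0 (rising l x).
    move: (normc _) => z z0 z1.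
    apply/andP; split; nra.
  rewrite (bigD1 i) //= xi lerDl sumr_ge0 // => j _; exact: ler0n.
have -> : normc (rising l x) = 1.
  rewrite /rising normc_prod big1_seq // => i /=; rewrite mem_index_iota => lt_il.
  apply: chi_norm; rewrite addr_eq0; apply: contra no => xi.
  by apply/existsP; exists (Ordinal lt_il).
by rewrite expr1n subrr normr0 sumr_ge0 // => j _; exact: ler0n.
Qed.

Section MeanSquare.

Variables (K L : nat).
Hypotheses (le_Kp : (K <= p)%N) (le_L : (L <= p + p)%N).

Let s : R := Num.sqrt p%:R.

(** The correlation is replaced by Q, whose k - l linear factors are distinct since K <= p, and
    Weil's bound with completion gives 2 K L s. The replacement errs only at the zeros of at most K
    factors, each met for at most 2 L pairs (i, j); as 1 <= s, this adds at most another 2 K L s. *)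
Lemma rising_pair_bound x0 k l : (k < K)%N -> (l < k)%N ->
  normc (\sum_(i < L) \sum_(j < L) rising k (x0 + (i%:R - j%:R))
            * conjc (rising l (x0 + (i%:R - j%:R))))
    <= 4 * K%:R * L%:R * s.
Proof.
move=> lt_kK lt_lk; pose Q x := \prod_(l <= i < k) chi (x + i.+1%:R).
pose y i j : 'F_p := x0 + (i%:R - j%:R).
have s1 : 1 <= s by rewrite -sqrtr1 ler_wsqrtr // ler1n.
have main : normc (\sum_(i < L) \sum_(j < L) Q (y i j)) <= (K%:R * s) * (2 * L)%:R.
  apply: (difference_sum_bound p_pr) => // psi psi0 psiD psi_norm.
  (* The change of sign brings the factors into the form b - x of [weil_bound]. *)
  rewrite (reindex_inj oppr_inj) /=.
  pose B : seq 'F_p := [seq i.+1%:R | i <- index_iota l k].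
  have uB : uniq B.
    rewrite map_inj_in_uniq ?iota_uniq // => a b; rewrite !mem_index_iota.
    move=> /andP[_ a_k] /andP[_ b_k] /(congr1 val) /=.
    by rewrite !val_Fp_nat // !modn_small; try lia; case.
  have B0 : B != [::] by rewrite -size_eq0 size_map size_iota subn_eq0 -ltnNge.
  have -> : \sum_x Q (- x) * psi (- x) =
      \sum_x (\prod_(b <- B) chi (b - x)) * psi (- x).
    by apply: eq_bigr => x _; rewrite /Q big_map; congr (_ * _);
      apply: eq_bigr => i _; rewrite addrC.
  apply: le_trans (weil_bound p_pr chi0 chi1 chiM chi_sum chi_norm
    (psi := fun x => psi (- x)) _ _ _ uB B0) _.
  - by rewrite oppr0.
  - by move=> u v; rewrite opprD psiD.
  - by move=> u; apply: psi_norm.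
  rewrite ler_wpM2r ?sqrtr_ge0 // ler_nat size_map size_iota; lia.
have err : normc (\sum_(i < L) \sum_(j < L)
     (rising k (y i j) * conjc (rising l (y i j)) - Q (y i j))) <= (K * (2 * L))%:R.
  apply: le_trans (normc_sum _ _ _) _.
  apply: (@le_trans _ _ (\sum_(i < L) \sum_(j < L) \sum_(u < l)
            (y i j == - u.+1%:R)%:R)).
    apply: ler_sum => i _; apply: le_trans (normc_sum _ _ _) _.
    by apply: ler_sum => j _; apply: rising_correlation; exact: ltnW.
  under eq_bigr => i _ do rewrite exchange_big /=.
  rewrite exchange_big /=.
  apply: (@le_trans _ _ (\sum_(u < l) (2 * L)%:R)).
    apply: ler_sum => u _.
    apply: le_trans (_ : (\sum_(i < L) \sum_(j < L)
      (i%:R - j%:R == - x0 - u.+1%:R :> 'F_p)%R)%N%:R <= _).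
      rewrite natr_sum; rewrite le_eqVlt; apply/orP; left; apply/eqP/eq_bigr => i _.
      rewrite natr_sum; apply: eq_bigr => j _; congr (nat_of_bool _)%:R.
      by rewrite /y -(inj_eq (addrI (- x0))) addKr.
    by rewrite ler_nat count_difference.
  rewrite sumr_const card_ord -mulrnA ler_nat mulnC leq_mul2r.
  by apply/orP; right; lia.
have -> : \sum_(i < L) \sum_(j < L) rising k (x0 + (i%:R - j%:R))
            * conjc (rising l (x0 + (i%:R - j%:R)))
   = \sum_(i < L) \sum_(j < L) Q (y i j) + \sum_(i < L) \sum_(j < L)
     (rising k (y i j) * conjc (rising l (y i j)) - Q (y i j)).
  rewrite -big_split; apply: eq_bigr => i _; rewrite -big_split.
  by apply: eq_bigr => j _ /=; rewrite addrC subrK.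
apply: le_trans (le_normcD _ _) _.
apply: le_trans (lerD main err) _.
rewrite !natrM; have K0 : 0 <= K%:R :> R by []; have L0 : 0 <= L%:R :> R by [].
have := mulr_ge0 K0 L0; nra.
Qed.

(** When the square is expanded, each of the K diagonal pairs contributes at most L^2, and the fewer
    than K^2 others fall under [rising_pair_bound]. *)
Lemma rising_mean_square x0 :
  \sum_(i < L) \sum_(j < L)
     normc (\sum_(k < K) rising k (x0 + (i%:R - j%:R))) ^+ 2
    <= K%:R * L%:R ^+ 2 + 4 * K%:R ^+ 3 * L%:R * s.
Proof.
pose y i j : 'F_p := x0 + (i%:R - j%:R).
pose D k l := \sum_(i < L) \sum_(j < L) rising k (y i j) * conjc (rising l (y i j)).
have DC k l : normc (D k l) = normc (D l k).
  rewrite -normc_conj /D rmorph_sum; congr normc; apply: eq_bigr => i _ /=.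
  rewrite rmorph_sum; apply: eq_bigr => j _ /=.
  by rewrite rmorphM /= conjcK mulrC.
have D_diag k : normc (D k k) <= L%:R ^+ 2.
  apply: le_trans (normc_sum _ _ _) _.
  have cstL (c : R) : \sum_(i < L) c = c * L%:R by rewrite sumr_const card_ord mulr_natr.
  rewrite expr2 -cstL; apply: ler_sum => i _; apply: le_trans (normc_sum _ _ _) _.
  rewrite -[leRHS]mul1r -cstL; apply: ler_sum => j _.
  rewrite normcM normc_conj mulr_ile1 ?normc_ge0 //; exact: rising_le1.
have s0 : 0 <= s by apply: sqrtr_ge0.
have D_le (k l : 'I_K) : normc (D k l) <=
    (if k == l then L%:R ^+ 2 else 0) + 4 * K%:R * L%:R * s.
  have b0 : 0 <= 4 * K%:R * L%:R * s by rewrite !mulr_ge0.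
  case: eqVneq => [->|ne]; first by rewrite ler_wpDr.
  rewrite add0r; have [lt|lt|e] := ltngtP k l.
  - by rewrite DC rising_pair_bound.
  - by rewrite rising_pair_bound.
  by rewrite (val_inj e) eqxx in ne.
set W := \sum_(i < L) _.
have W0 : 0 <= W.
  by apply: sumr_ge0 => i _; apply: sumr_ge0 => j _; exact: sqr_ge0.
rewrite -(ger0_norm W0) -normc_real.
have -> : W%:C%C = \sum_(k < K) \sum_(l < K) D k l.
  rewrite rmorph_sum /=.
  under [RHS]eq_bigr => k _ do rewrite exchange_big /=.
  rewrite [RHS]exchange_big /=; apply: eq_bigr => i _; rewrite rmorph_sum /=.
  under [RHS]eq_bigr => k _ do rewrite exchange_big /=.
  rewrite [RHS]exchange_big /=; apply: eq_bigr => j _.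
  rewrite normc_sqr mulr_suml; apply: eq_bigr => k _.
  by rewrite rmorph_sum mulr_sumr.
apply: le_trans (normc_sum _ _ _) _.
apply: (@le_trans _ _ (\sum_(k < K) (L%:R ^+ 2 + K%:R * (4 * K%:R * L%:R * s)))).
  apply: ler_sum => k _; apply: le_trans (normc_sum _ _ _) _.
  apply: le_trans (ler_sum _ (fun l _ => D_le k l)) _.
  rewrite big_split /= sumr_const card_ord [K%:R * (4 * _ * _ * _)]mulr_natl lerD2r.
  rewrite (bigD1 k) //= eqxx big1 ?addr0 // => l lk.
  by rewrite eq_sym (negbTE lk).
rewrite sumr_const card_ord -mulr_natl le_eqVlt; apply/orP; left; apply/eqP; ring.
Qed.

End MeanSquare.

Section ShiftedSums.

Variables (H N K : nat).
Hypotheses (HN_lt : (H + N < p)%N) (K_gt0 : (0 < K)%N) (le_KN : (K <= N)%N).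

Let s : R := Num.sqrt p%:R.
Let u t : C := chi (H + t.+1)`!%:R.
Let S : C := \sum_(t < N) u t.
Let A x := \sum_(k < K) rising k x.
Let x0 : 'F_p := H.+1%:R.

Lemma fact_shift t k : u (t + k) = u t * rising k (x0 + t%:R).
Proof.
elim: k => [|k IH]; first by rewrite addn0 /rising big_geq ?mulr1.
rewrite /rising big_nat_recr //= -/(rising _ _) mulrA -IH /u -chiM; congr chi.
rewrite /x0 -!natrD -natrM mulnC; congr (_%:R).
have -> : (H + (t + k.+1).+1 = (H + (t + k).+1).+1)%N by lia.
by rewrite factS; congr (_ * _)%N; lia.
Qed.

Lemma shift_average :
  normc (K%:R * S) <= \sum_(t < N) normc (A (x0 + t%:R)) + K%:R ^+ 2.
Proof.
(* With this length t + k stays below N for every k < K, and each shifted sum misses only K - 1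
   terms of S. *)
pose M := (N - K.-1)%N.
have u1 t : normc (u t) <= 1 by apply: chi_le1.
have sum_u (a b : nat) : normc (\sum_(a <= t < b) u t) <= (b - a)%:R.
  apply: le_trans (normc_sum _ _ _) _.
  apply: le_trans (ler_sum _ (fun t _ => u1 t)) _.
  by rewrite big_const_nat iter_addr_0.
have S_k (k : 'I_K) : normc (S - \sum_(t < M) u (t + k)) <= K%:R.
  have kM : (k + M <= N)%N by rewrite /M; have := ltn_ord k; lia.
  rewrite /S -(big_mkord xpredT u) -(big_mkord xpredT (fun t => u (t + k))).
  have <- : \sum_(k <= t < k + M) u t = \sum_(0 <= t < M) u (t + k).
    by rewrite -{1}[nat_of_ord k]add0n big_addn addKn.
  rewrite (@big_cat_nat _ _ _ k) //=; last by lia.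
  rewrite (@big_cat_nat _ _ _ (k + M) k N) ?leq_addr //=.
  rewrite addrCA addrAC subrr add0r.
  apply: le_trans (le_normcD _ _) _; apply: le_trans (lerD (sum_u _ _) (sum_u _ _)) _.
  by rewrite -natrD ler_nat /M; have := ltn_ord k; lia.
have E : K%:R * S = \sum_(t < M) u t * A (x0 + t%:R)
    + \sum_(k < K) (S - \sum_(t < M) u (t + k)).
  rewrite sumrB sumr_const card_ord [\sum_(k < K) _]exchange_big /=.
  rewrite (eq_bigr (fun t : 'I_M => \sum_(k < K) u (t + k))) => [|t _].
    by rewrite addrC subrK mulr_natl.
  by rewrite /A mulr_sumr; apply: eq_bigr => k _; rewrite fact_shift.
rewrite E; apply: le_trans (le_normcD _ _) _; apply: lerD.
  apply: le_trans (normc_sum _ _ _) _.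
  have le_MN : (M <= N)%N by rewrite leq_subr.
  rewrite (big_ord_widen N (fun t => normc (u t * A (x0 + t%:R))) le_MN) big_mkcond /=.
  apply: ler_sum => t _; case: ifP => _; last exact: normc_ge0.
  by rewrite normcM ler_piMl ?normc_ge0.
apply: le_trans (normc_sum _ _ _) _; apply: le_trans (ler_sum _ (fun k _ => S_k k)) _.
by rewrite sumr_const card_ord -[leLHS]mulr_natl expr2.
Qed.

(** Each t < N is the difference (t + j) - j for all N values j < N, with both indices below N + N;
    the remaining terms of the weighted sum are nonnegative. *)
Lemma interval_mean_square :
  N%:R * \sum_(t < N) normc (A (x0 + t%:R)) ^+ 2
    <= K%:R * (N + N)%:R ^+ 2 + 4 * K%:R ^+ 3 * (N + N)%:R * s.
Proof.
have le_Kp : (K <= p)%N by lia.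
have le_Lp : (N + N <= p + p)%N by lia.
apply: le_trans (rising_mean_square le_Kp le_Lp x0).
pose F i j := normc (A (x0 + (i%:R - j%:R))) ^+ 2.
have F0 i j : 0 <= F i j by apply: sqr_ge0.
rewrite [leRHS]exchange_big /=.
have -> : N%:R * \sum_(t < N) normc (A (x0 + t%:R)) ^+ 2
    = \sum_(j < N) \sum_(t < N) F (t + j)%N j.
  rewrite [RHS](eq_bigr (fun=> \sum_(t < N) normc (A (x0 + t%:R)) ^+ 2)).
    by rewrite sumr_const card_ord mulr_natl.
  by move=> j _; apply: eq_bigr => t _; rewrite /F natrD addrK.
rewrite (big_ord_widen (N + N) (fun j => \sum_(t < N) F (t + j)%N j)) ?leq_addr //.
rewrite big_mkcond /=; apply: ler_sum => j _.
case: ifP => [lt_jN|_]; last by apply: sumr_ge0 => i _; exact: F0.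
rewrite -(big_mkord xpredT (fun t => F (t + j)%N j)) -(big_mkord xpredT (fun i => F i j)).
have <- : \sum_(j <= i < j + N) F i j = \sum_(0 <= t < N) F (t + j)%N j.
  by rewrite -{1}[nat_of_ord j]add0n big_addn addKn.
rewrite [leRHS](@big_cat_nat _ _ _ j) //=; last by lia.
rewrite (@big_cat_nat _ _ _ (j + N) j (N + N)) ?leq_addr //=; last by lia.
rewrite addrCA lerDl addr_ge0 // sumr_ge0 // => i _; exact: F0.
Qed.

(** With T the sum of the |A|, (K |S|)^2 <= 2 T^2 + 2 K^4, and by Cauchy-Schwarz T^2 is at most the
    bound of [interval_mean_square], where N + N yields the factors 4 and 8. *)
Lemma factorial_sum_sqr :
  K%:R * normc S ^+ 2
    <= 8 * N%:R ^+ 2 + 16 * N%:R * K%:R ^+ 2 * s + 2 * K%:R ^+ 3.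
Proof.
have K0 : 0 < K%:R :> R by rewrite ltr0n.
have := shift_average; have := interval_mean_square.
have := sqr_sum_le predT (fun t : 'I_N => normc (A (x0 + t%:R))).
rewrite card_ord normcM normc_nat.
set T := \sum_(t < N) normc _; set V := \sum_(t < N) normc _ ^+ 2.
move=> leT leV le1.
have le2 : (K%:R * normc S) ^+ 2 <= 2 * T ^+ 2 + 2 * (K%:R ^+ 2) ^+ 2.
  apply: (@le_trans _ _ ((T + K%:R ^+ 2) ^+ 2)).
    by rewrite ler_sqr ?nnegrE ?(le_trans _ le1) ?mulr_ge0 ?normc_ge0 // ltW.
  have := sqr_ge0 (T - K%:R ^+ 2); lra.
rewrite -(ler_pM2l K0).
have -> : K%:R * (K%:R * normc S ^+ 2) = (K%:R * normc S) ^+ 2 by ring.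
apply: le_trans le2 _; rewrite natrD in leV.
have : 2 * T ^+ 2 <= 2 * (K%:R * (N%:R + N%:R) ^+ 2 + 4 * K%:R ^+ 3 * (N%:R + N%:R) * s).
  by rewrite ler_pM2l // (le_trans leT).
lra.
Qed.

End ShiftedSums.

End FactorialSum.

(* K is the integer part of sqrt (N / s); it is used with s = sqrt p. *)
Lemma optimal_shift (F : archiRealFieldType) (N s X : F) :
    1 <= s -> s <= N -> 0 <= X ->
    (forall K : nat, (0 < K)%N -> K%:R ^+ 2 * s <= N ->
       K%:R * X ^+ 2 <= 8 * N ^+ 2 + 16 * N * K%:R ^+ 2 * s + 2 * K%:R ^+ 3) ->
  forall k : F, 0 <= k -> k ^+ 2 * s = N -> X ^+ 4 <= 34 ^+ 2 * N ^+ 3 * s.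
Proof.
move=> s1 sN X0 H k k0 kE.
have s0 : 0 < s by lra.
have N0 : 0 < N by lra.
have k1 : 1 <= k.
  rewrite leNgt; apply/negP => lt.
  have : k ^+ 2 * s < 1 * s by rewrite ltr_pM2r // expr_lt1.
  lra.
have /andP[leK ltK] := truncn_itv k0.
have K_gt0 : (0 < Num.truncn k)%N by rewrite truncn_gt_nat.
have K1 : 1 <= (Num.truncn k)%:R :> F by rewrite ler1n.
rewrite -natr1 in ltK; have := H _ K_gt0.
move: ((Num.truncn k)%:R : F) leK ltK K1 => K leK ltK K1 HK.
have K2s : K ^+ 2 * s <= N.
  by rewrite -kE ler_pM2r // ler_sqr ?nnegrE //; lra.
have {}HK := HK K2s.
have k2K : k <= 2 * K by lra.
have KK : K ^+ 2 <= k ^+ 2 by rewrite ler_sqr ?nnegrE //; lra.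
(* 34 = 16 + 16 + 2, one summand for each term of the bound; k <= 2 K doubles the first coefficient
   8. *)
have sqX : X ^+ 2 <= 34 * N * k * s.
  rewrite -(@ler_pM2l _ K); last by lra.
  apply: le_trans HK _.
  have : N ^+ 2 <= N * k * s * (2 * K).
    rewrite expr2 -{2}kE (_ : N * (k ^+ 2 * s) = N * k * s * k); last by ring.
    by rewrite ler_pM2l // !mulr_gt0 //; lra.
  have Nks : N * K ^+ 2 * s <= K * (N * k * s).
    rewrite (_ : N * K ^+ 2 * s = N * K * s * K); last by ring.
    rewrite (_ : K * (N * k * s) = N * K * s * k); last by ring.
    by rewrite ler_pM2l // !mulr_gt0 //; lra.
  have : K ^+ 3 <= N * K ^+ 2 * s.
    rewrite (_ : K ^+ 3 = K ^+ 2 * K); last by ring.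
    rewrite (_ : N * K ^+ 2 * s = K ^+ 2 * (N * s)); last by ring.
    rewrite ler_pM2l ?exprn_gt0 //; last by lra.
    have : K <= K ^+ 2 * s by nra.
    have : N <= N * s by rewrite ler_peMr //; lra.
    lra.
  lra.
rewrite (_ : X ^+ 4 = (X ^+ 2) ^+ 2); last by rewrite -exprM.
have Y0 : 0 <= 34 * N * k * s by rewrite !mulr_ge0 //; lra.
apply: (@le_trans _ _ ((34 * N * k * s) ^+ 2)).
  by rewrite ler_sqr ?nnegrE ?sqr_ge0.
rewrite (_ : (34 * N * k * s) ^+ 2 = 34 ^+ 2 * N ^+ 2 * (k ^+ 2 * s) * s); last by ring.
by rewrite kE le_eqVlt; apply/orP; left; apply/eqP; ring.
Qed.

Section FactorialSumBound.

Variables (p : nat) (p_pr : prime p) (R : realType).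
Local Notation C := R[i].
Variable chi : 'F_p -> C.
Hypotheses (chi0 : chi 0 = 0) (chi1 : chi 1 = 1).
Hypothesis chiM : {morph chi : x y / x * y}.
Hypothesis chi_sum : \sum_x chi x = 0.
Hypothesis chi_norm : forall x, x != 0 -> normc (chi x) = 1.

(** This is |S(chi)| << N^(3/4) p^(1/8), raised to the fourth power to avoid fractional
    exponents. *)
Theorem factorial_sum_bound H N : (H + N < p)%N ->
  normc (\sum_(t < N) chi (H + t.+1)`!%:R) ^+ 4
    <= 34 ^+ 2 * N%:R ^+ 3 * Num.sqrt p%:R.
Proof.
move=> HN; set X := normc _; set s := Num.sqrt _.
have X0 : 0 <= X := normc_ge0 _.
have s1 : 1 <= s by rewrite -sqrtr1 ler_wsqrtr // ler1n prime_gt0.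
(* For N < sqrt p no shift K >= 1 is available, but the trivial bound N is then good enough. *)
have [sN|Ns] := leP s N%:R; last first.
  have XN : X <= N%:R.
    apply: le_trans (normc_sum _ _ _) _.
    apply: le_trans (ler_sum _ (fun t _ => chi_le1 chi0 chi_norm _)) _.
    by rewrite sumr_const card_ord.
  apply: (@le_trans _ _ (N%:R ^+ 4)); first by rewrite lerXn2r ?nnegrE.
  rewrite exprSr; have : 0 <= N%:R ^+ 3 :> R by rewrite exprn_ge0.
  move: (N%:R ^+ 3) => y y0.
  have := ler_wpM2l y0 (ltW Ns); have := mulr_ge0 y0 (le_trans ler01 s1).
  lra.
have s0 : 0 < s := lt_le_trans ltr01 s1.
apply: (optimal_shift s1 sN X0 _ (k := Num.sqrt (N%:R / s))); last 2 first.
- exact: sqrtr_ge0.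
- by rewrite sqr_sqrtr ?divfK ?gt_eqF // divr_ge0 // ltW.
move=> K K0 KN; apply: (factorial_sum_sqr p_pr) => //.
rewrite -(ler_nat R); apply: le_trans KN.
have : 1 <= K%:R :> R by rewrite ler1n.
nra.
Qed.

End FactorialSumBound.

(** * The moments of S(chi) *)

Section FactorialEnergy.

Variables (p : nat) (p_pr : prime p) (F : realFieldType) (H N : nat).
Hypothesis HN_lt : (H + N < p)%N.

Let f t : 'F_p := (H + t.+1)`!%:R.

(* The number of (t_1, ..., t_r) such that the product of the f t_i is l. *)
Fixpoint fact_conv r (l : 'F_p) : F :=
  if r is r'.+1 then \sum_(t < N) fact_conv r' (l / f t) else (l == 1)%:R.

Lemma fact_neq0 n : (n < p)%N -> n`!%:R != 0 :> 'F_p.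
Proof.
move=> lt_np; rewrite -(dvdn_pcharf (pchar_Fp p_pr)).
elim: n lt_np => [|n IH] lt_np; first by rewrite dvdn1 gtn_eqF ?prime_gt1.
by rewrite factS Euclid_dvdM // negb_or gtnNdvd //= IH // ltnW.
Qed.

Lemma shifted_fact_neq0 t : (t < N)%N -> f t != 0.
Proof. by move=> ltt; apply: fact_neq0; lia. Qed.

Lemma fact_conv_ge0 r l : 0 <= fact_conv r l.
Proof. by elim: r l => [|r IH] l //=; apply: sumr_ge0 => t _; apply: IH. Qed.

Lemma fact_conv0 r : fact_conv r 0 = 0.
Proof.
elim: r => [|r IH] /=; first by [].
by rewrite big1 // => t _; rewrite mul0r.
Qed.

Lemma sum_fact_conv r : \sum_l fact_conv r l = N%:R ^+ r.
Proof.
elim: r => [|r IH] /=.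
  rewrite (bigD1 1) // eqxx big1; first exact: addr0.
  by move=> l; case: eqP.
rewrite exchange_big /= (eq_bigr (fun=> N%:R ^+ r)) => [|t _].
  by rewrite sumr_const card_ord -[LHS]mulr_natl exprS.
by rewrite -IH [RHS](reindex_inj (mulIf (invr_neq0 (shifted_fact_neq0 (ltn_ord t))))).
Qed.

(** This is J_r, and by [moment_energy] the 2r-th moment of the character sums divided by p - 1. *)
Definition energy r := \sum_l fact_conv r l ^+ 2.

(** Counts the pairs of r-tuples whose products become equal after multiplication by [f t] and [f u]
    respectively. *)
Let corr r t u := \sum_l fact_conv r (l / f t) * fact_conv r (l / f u).

Lemma shifted_product_count (m c : 'F_p) k : (0 < k)%N -> m != 0 ->
  (\sum_(t < N) ((t + k < N)%N && (m * (f (t + k) / f t) == c)%R) <= k)%N.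
Proof.
move=> k0 m0.
(* As [f t] is (H + t + 1)!, the quotient f (t + k) / f t starts with the factor t + H + 2. *)
pose P : {poly 'F_p} := \prod_(i <- iota 0 k) ('X - (- (H + i.+2)%:R)%:P).
have fk t j : (t + j < N)%N ->
    f (t + j) / f t = \prod_(i <- iota 0 j) (t%:R + (H + i.+2)%:R).
  elim: j => [|j IH] ltN.
    by rewrite addn0 divff ?big_nil // shifted_fact_neq0 // -(addn0 t).
  rewrite -[j.+1]addn1 iotaD big_cat big_seq1 /= add0n -IH; last by lia.
  rewrite mulrAC -natrD; congr (_ / _); rewrite /f -natrM.
  rewrite /f; have -> : (H + (t + (j + 1)).+1 = (H + (t + j).+1).+1)%N by lia.
  by rewrite factS mulnC; congr (_ * _)%:R; lia.
have size_P : size P = k.+1 by rewrite size_prod_XsubC size_iota.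
have size_q : size (m *: P - c%:P) = k.+1.
  rewrite size_polyDl size_scale // size_P //.
  by rewrite size_polyN (leq_ltn_trans (size_polyC_leq1 _)).
have q0 : m *: P - c%:P != 0 by rewrite -size_poly_gt0 size_q.
pose s : seq 'F_p :=
  [seq t%:R | t <- iota 0 N & (t + k < N)%N && (m * (f (t + k) / f t) == c)].
have us : uniq s.
  rewrite map_inj_in_uniq ?filter_uniq ?iota_uniq // => a b.
  rewrite !mem_filter !mem_iota => /andP[_ la] /andP[_ lb] /(congr1 val) /=.
  by rewrite !val_Fp_nat // !modn_small; lia.
have root_s : all (root (m *: P - c%:P)) s.
  apply/allP => _ /mapP[t + ->]; rewrite mem_filter => /andP[/andP[lt_N /eqP tc] _].
  rewrite rootE !hornerE -tc fk // subr_eq0; apply/eqP; congr (_ * _).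
  rewrite /P horner_prod; apply: eq_bigr => i _.
  by rewrite hornerXsubC opprK.
have := max_poly_roots q0 root_s us; rewrite size_q ltnS.
rewrite size_map size_filter; apply: leq_trans.
rewrite -(big_mkord xpredT
  (fun t => ((t + k < N)%N && (m * (f (t + k) / f t) == c)%R) : nat)).
by rewrite -big_mkcond sum1_count /index_iota subn0.
Qed.

Lemma corr_sym r t u : corr r t u = corr r u t.
Proof. by apply: eq_bigr => l _; rewrite mulrC. Qed.

Lemma corr_ge0 r t u : 0 <= corr r t u.
Proof. by apply: sumr_ge0 => l _; rewrite mulr_ge0 ?fact_conv_ge0. Qed.

Lemma corr_diag r t : (t < N)%N -> corr r t t = energy r.
Proof.
move=> ltN; rewrite /energy.
rewrite [RHS](reindex_inj (mulIf (invr_neq0 (shifted_fact_neq0 ltN)))).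
by apply: eq_bigr => l _; rewrite expr2.
Qed.

(** Once the values m and c of the two r-fold products are fixed, at most k indices t are compatible
    with them; summing over m and c gives N^r twice. *)
Lemma corr_shift r k : (0 < k)%N ->
  \sum_(t < N) (if (t + k < N)%N then corr r t (t + k) else 0)
    <= k%:R * N%:R ^+ (2 * r).
Proof.
move=> k0.
have -> : \sum_(t < N) (if (t + k < N)%N then corr r t (t + k) else 0) =
    \sum_m fact_conv r m * \sum_c fact_conv r c *
     (\sum_(t < N) ((t + k < N)%N && (m * (f (t + k) / f t) == c)%R))%N%:R.
  under [RHS]eq_bigr => m _ do
    (under eq_bigr => c _ do rewrite natr_sum mulr_sumr; rewrite exchange_big mulr_sumr).
  rewrite [RHS]exchange_big /=; apply: eq_bigr => t _.
  case: ifP => [lt_N|_] /=; last first.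
    by rewrite big1 // => m _; rewrite big1 ?mulr0 // => c _; rewrite mulr0.
  rewrite /corr (reindex_inj (mulIf (shifted_fact_neq0 lt_N))) /=.
  apply: eq_bigr => m _; rewrite mulfK ?shifted_fact_neq0 // mulrC; congr (_ * _).
  rewrite (bigD1 (m * (f (t + k) / f t))) //= eqxx mulr1 big1 ?addr0 ?mulrA //.
  by move=> c /negbTE; rewrite eq_sym => ->; rewrite mulr0.
have Nr0 : 0 <= k%:R * N%:R ^+ r :> F by rewrite mulr_ge0 ?exprn_ge0.
apply: (@le_trans _ _ (\sum_m fact_conv r m * (k%:R * N%:R ^+ r))).
  apply: ler_sum => m _; have [->|m0] := eqVneq m 0; first by rewrite fact_conv0 !mul0r.
  rewrite ler_wpM2l ?fact_conv_ge0 // -sum_fact_conv mulr_sumr.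
  apply: ler_sum => c _; rewrite mulrC ler_wpM2r ?fact_conv_ge0 // ler_nat.
  exact: shifted_product_count.
by rewrite -mulr_suml sum_fact_conv mulrCA -exprD mul2n addnn.
Qed.

Lemma energy_rec r K : (0 < K)%N ->
  energy r.+1 <= (N %/ K).+1%:R * (N%:R * energy r + K%:R ^+ 2 * N%:R ^+ (2 * r)).
Proof.
move=> K0.
(* Cauchy-Schwarz over the blocks, indexed by t %/ K, leaves only pairs in a common block. *)
have blk l : fact_conv r.+1 l ^+ 2 <= (N %/ K).+1%:R *
    \sum_(t < N) \sum_(u < N | (u %/ K == t %/ K)%N)
       fact_conv r (l / f t) * fact_conv r (l / f u).
  pose b (t : 'I_N) : 'I_(N %/ K).+1 := inord (t %/ K)%N.
  have bE t : b t = (t %/ K)%N :> nat.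
    by rewrite inordK // ltnS leq_div2r // ltnW.
  rewrite /= (partition_big b xpredT) //=.
  apply: le_trans (sqr_sum_le _ _) _; rewrite cardT size_enum_ord ler_wpM2l //.
  rewrite [leRHS](partition_big b xpredT) //=.
  apply: ler_sum => c _; rewrite expr2 mulr_suml; apply: ler_sum => t /eqP tc.
  rewrite mulr_sumr le_eqVlt; apply/orP; left; apply/eqP/eq_bigl => u.
  by rewrite -tc -(inj_eq val_inj) /= !bE.
apply: le_trans (ler_sum _ (fun l _ => blk l)) _.
rewrite -mulr_sumr ler_wpM2l // exchange_big /=.
under eq_bigr => t _ do rewrite exchange_big /=.
(* Two indices in one block agree or differ by some k with 0 < k < K, in one direction or the other.
   Sorting by k lets [corr_shift] be applied to each difference. *)
have le_pair (t u : 'I_N) : (u %/ K == t %/ K)%N -> corr r t u <=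
    (if u == t then energy r else 0)
    + \sum_(k < K) (if (0 < k)%N && (u == t + k :> nat)%N then corr r t u else 0)
    + \sum_(k < K) (if (0 < k)%N && (t == u + k :> nat)%N then corr r t u else 0).
  move=> /eqP same.
  have close : (u < t + K)%N /\ (t < u + K)%N.
    rewrite (divn_eq u K) same {1 4}(divn_eq t K).
    by have := ltn_pmod u K0; have := ltn_pmod t K0; split; lia.
  have s0 (P : pred 'I_K) : 0 <= \sum_(k < K) (if P k then corr r t u else 0).
    by apply: sumr_ge0 => k _; case: ifP => // _; exact: corr_ge0.
  have e0 : 0 <= (if u == t then energy r else 0).
    by case: ifP => // _; rewrite -(corr_diag r (ltn_ord t)) corr_ge0.
  have single (P : pred 'I_K) k : P k ->
      corr r t u <= \sum_(k < K) (if P k then corr r t u else 0).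
    move=> Pk; rewrite (bigD1 k) //= Pk lerDl sumr_ge0 // => j _.
    by case: ifP => // _; exact: corr_ge0.
  have [ltut|lttu|/val_inj ut] := ltngtP u t.
  - have ltK : (t - u < K)%N by lia.
    rewrite -[leLHS]add0r lerD ?addr_ge0 //.
    by apply: (single _ (Ordinal ltK)) => /=; rewrite subn_gt0 ltut subnKC ?eqxx // ltnW.
  - have ltK : (u - t < K)%N by lia.
    rewrite -[leLHS]addr0 lerD // -[leLHS]add0r lerD //.
    by apply: (single _ (Ordinal ltK)) => /=; rewrite subn_gt0 lttu subnKC ?eqxx // ltnW.
  have -> : u == t by apply/eqP.
  by rewrite {1}ut corr_diag // -addrA lerDl addr_ge0.
have shiftE k (g : nat -> nat -> F) :
    \sum_(t < N) \sum_(u < N) (if (0 < k)%N && (u == t + k :> nat)%N then g t u else 0)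
    = if (0 < k)%N then \sum_(t < N) (if (t + k < N)%N then g t (t + k)%N else 0) else 0.
  case: ifP => [k0|_]; last by rewrite big1 // => t _; rewrite big1.
  apply: eq_bigr => t _; case: ifP => [lt_N|ge_N].
    rewrite (bigD1 (Ordinal lt_N)) //= eqxx big1 ?addr0 // => u.
    by rewrite -val_eqE /= => /negbTE->.
  rewrite big1 // => u _; case: eqP => // uE.
  by have := ltn_ord u; rewrite uE ge_N.
have sum_k : \sum_(k < K) (if (0 < k)%N then
      \sum_(t < N) (if (t + k < N)%N then corr r t (t + k)%N else 0) else 0)
    <= (\sum_(k < K) k)%N%:R * N%:R ^+ (2 * r).
  rewrite natr_sum mulr_suml; apply: ler_sum => k _.
  by case: ifP => [k0|_]; [exact: corr_shift|rewrite mulr_ge0 ?exprn_ge0].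
apply: (@le_trans _ _ (\sum_(t < N) \sum_(u < N)
    ((if u == t then energy r else 0)
    + \sum_(k < K) (if (0 < k)%N && (u == t + k :> nat)%N then corr r t u else 0)
    + \sum_(k < K) (if (0 < k)%N && (t == u + k :> nat)%N then corr r t u else 0)))).
  apply: ler_sum => t _; rewrite big_mkcond; apply: ler_sum => u _.
  have [ut|nut] := ifP; first exact: le_pair.
  rewrite !addr_ge0 //.
    by case: ifP => // _; rewrite -(corr_diag r (ltn_ord t)) corr_ge0.
    by apply: sumr_ge0 => k _; case: ifP => // _; exact: corr_ge0.
  by apply: sumr_ge0 => k _; case: ifP => // _; exact: corr_ge0.
under eq_bigr => t _ do rewrite !big_split /=.
rewrite !big_split /= -addrA lerD //.
  rewrite (eq_bigr (fun=> energy r)) => [|t _].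
    by rewrite sumr_const card_ord mulr_natl.
  by rewrite -big_mkcond big_pred1_eq.
have K2 : (\sum_(k < K) k + \sum_(k < K) k <= K * K)%N.
  elim: (K) => [|k IH]; rewrite ?big_ord0 // !big_ord_recr /= mulSn mulnS.
  by move: (\sum_(i < k) _)%N (k * k)%N IH => a b; lia.
apply: (@le_trans _ _ ((\sum_(k < K) k)%N%:R * N%:R ^+ (2 * r)
                     + (\sum_(k < K) k)%N%:R * N%:R ^+ (2 * r))); last first.
  by rewrite -mulrDl -natrD expr2 -natrM ler_wpM2r ?exprn_ge0 // ler_nat.
apply: lerD; apply: le_trans sum_k; rewrite le_eqVlt; apply/orP; left; apply/eqP.
  under eq_bigr => t _ do rewrite exchange_big /=.
  by rewrite exchange_big /=; apply: eq_bigr => k _; exact: (shiftE k (corr r)).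
under eq_bigr => t _ do rewrite exchange_big /=.
rewrite exchange_big /=; apply: eq_bigr => k _; rewrite exchange_big /=.
rewrite -(shiftE k (corr r)); apply: eq_bigr => t _; apply: eq_bigr => u _.
by rewrite corr_sym.
Qed.

End FactorialEnergy.

(** The extra factor N on the left keeps the exponents nonnegative. For k = N^(2^-(r+1)) the
    induction hypothesis reads N J_r <= C N^(2r) k^2, which balances K^2 N^(2r) when K is k rounded
    up. The new constant 2 (C + 4) combines K^2 <= 4 k^2 with at most 2 N / k blocks. *)
Lemma energy_bound (R : realType) r : exists2 C : R, 0 < C &
  forall p H N, prime p -> (0 < N)%N -> (H + N < p)%N ->
    N%:R * energy p R H N r <= C * N%:R ^+ (2 * r) * N%:R `^ (2 ^- r).
Proof.
elim: r => [|r [C C0 IH]].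
  exists 1 => // p H N p_pr N0 HN; rewrite muln0 expr0 mulr1 mul1r expr0 invr1.
  rewrite powRr1 // /energy (bigD1 1) //= big1 => [|l /negbTE ->].
    by rewrite addr0 expr1n mulr1.
  by rewrite expr0n.
exists (2 * (C + 4)) => [|p H N p_pr N0 HN]; first by lra.
set k : R := N%:R `^ (2 ^- r.+1).
have N1 : 1 <= N%:R :> R by rewrite ler1n.
have k2 : N%:R `^ (2 ^- r) = k ^+ 2.
  rewrite -powR_mulrn ?powR_ge0 // -powRrM exprS invfM mulrC mulrA.
  by rewrite mulfV ?mul1r // pnatr_eq0.
have k1 : 1 <= k.
  by rewrite -[leLHS](powRr0 N%:R) ler_powR // invr_ge0 exprn_ge0.
have kN : k <= N%:R.
  by rewrite -[leRHS]powRr1 // ler_powR // invf_le1 ?exprn_gt0 // exprn_ege1 // ler1n.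
have k0 : 0 <= k := le_trans ler01 k1.
have /andP[leK ltK] := truncn_itv k0; set K := (Num.truncn k).+1.
have kK : k <= K%:R by apply: ltW.
have Kk : K%:R <= 2 * k by rewrite /K -[leLHS]natr1; lra.
have := IH p H N p_pr N0 HN; rewrite k2.
set E := energy _ _ _ _ r => IHE.
have := @energy_rec p p_pr R H N HN r K isT; rewrite -/E => recE.
have P0 : 0 <= N%:R ^+ (2 * r) :> R by rewrite exprn_ge0.
have blk : (N %/ K).+1%:R <= 2 * N%:R / k :> R.
  rewrite ler_pdivlMr ?(lt_le_trans ltr01) // -natr1 mulrDl mul1r.
  have : (N %/ K)%:R * k <= N%:R :> R.
    apply: (@le_trans _ _ ((N %/ K)%:R * K%:R)); first by rewrite ler_wpM2l.
    by rewrite -natrM ler_nat leq_trunc_div.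
  lra.
have K2 : K%:R ^+ 2 <= 4 * k ^+ 2.
  have -> : 4 * k ^+ 2 = (2 * k) ^+ 2 by ring.
  by rewrite ler_sqr ?nnegrE // mulr_ge0.
apply: (@le_trans _ _ (N%:R * (2 * N%:R / k * ((C + 4) * N%:R ^+ (2 * r) * k ^+ 2)))).
  rewrite ler_wpM2l //; apply: le_trans recE _.
  apply: ler_pM => //.
    by rewrite addr_ge0 ?mulr_ge0 ?exprn_ge0 //; apply: sumr_ge0 => l _; exact: sqr_ge0.
  have := ler_wpM2r P0 K2; lra.
rewrite le_eqVlt; apply/orP; left; apply/eqP.
rewrite mulnS exprD; field.
by rewrite gt_eqF // (lt_le_trans ltr01).
Qed.

(** * Expansion into characters *)

Section Fourier.

Variables (R : realType) (p : nat) (p_pr : prime p) (H N : nat).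
Hypothesis HN_lt : (H + N < p)%N.
Local Notation C := R[i].

Let f t : 'F_p := (H + t.+1)`!%:R.

Section OneCharacter.

Variable chi : 'F_p -> C.
Hypotheses (chi0 : chi 0 = 0) (chi1 : chi 1 = 1).
Hypothesis chiM : {morph chi : x y / x * y}.

(** The ell-th power expands over all choice functions, which are grouped by the value of the
    product of factorials. *)
Lemma count_transform ell :
  \sum_(a : 'F_p) (factorial_product_count ell H N a)%:R * chi a
    = (\sum_(t < N) chi (f t)) ^+ ell.
Proof.
pose valid (k : 'I_(H + N).+1) := (H + 1 <= k <= H + N)%N.
have -> : \sum_(t < N) chi (f t) = \sum_(k | valid k) chi (k`!%:R).
  rewrite -(big_mkord xpredT (fun t => chi (f t))).
  rewrite -(big_mkord (fun k => H + 1 <= k <= H + N)%N (fun k => chi (k`!%:R))).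
  rewrite [RHS](@big_cat_nat _ _ _ H.+1) //=; last by lia.
  rewrite [X in _ = X + _](_ : _ = 0) ?add0r; last first.
    by rewrite big_nat_cond big_pred0 // => k; lia.
  rewrite -[in RHS](add0n H.+1) big_addn (_ : (H + N).+1 - H.+1 = N)%N; last by lia.
  rewrite [LHS]big_nat_cond [RHS]big_nat_cond; apply: eq_big => t; first by lia.
  by move=> _; rewrite /f; congr (chi (_`!)%:R); lia.
have -> (z : C) : z ^+ ell = \prod_(i < ell) z by rewrite prodr_const card_ord.
rewrite (bigA_distr_big valid) /=.
transitivity (\sum_(n : {ffun 'I_ell -> 'I_(H + N).+1} | [forall i, valid (n i)])
    chi (\prod_(i < ell) ((n i)`!)%:R)).
  rewrite (partition_big (fun n : {ffun 'I_ell -> 'I_(H + N).+1} =>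
    \prod_(i < ell) ((n i)`!)%:R : 'F_p) xpredT) //=.
  apply: eq_bigr => a _; rewrite (eq_bigr (fun=> chi a)) => [|n /andP[_ /eqP->]] //.
  by rewrite sumr_const -[RHS]mulr_natl /factorial_product_count cardsE.
apply: eq_big => n; last by move=> _; rewrite (big_morph chi chiM chi1).
by apply/forallP/ffun_onP.
Qed.

Lemma fact_conv_transform r :
  \sum_(l : 'F_p) (fact_conv R H N r l)%:C%C * chi l
    = (\sum_(t < N) chi (f t)) ^+ r.
Proof.
elim: r => [|r IH].
  rewrite (bigD1 1) //= big1 ?addr0 ?chi1 ?mulr1 //.
  by move=> l /negbTE->; rewrite mul0r.
rewrite exprS -IH mulr_suml /=.
under eq_bigr => l _ do rewrite rmorph_sum mulr_suml.
rewrite exchange_big /=; apply: eq_bigr => t _.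
have ft0 := shifted_fact_neq0 p_pr HN_lt (ltn_ord t).
rewrite (reindex_inj (mulIf ft0)) mulr_sumr; apply: eq_bigr => l _ /=.
by rewrite mulfK // chiM; ring.
Qed.

End OneCharacter.

Section Family.

Variable X : 'I_p.-1 -> 'F_p -> C.
Hypotheses (X0 : forall j, X j 0 = 0) (X1 : forall j, X j 1 = 1).
Hypothesis XM : forall j, {morph X j : x y / x * y}.
Hypothesis Xn : forall j x, x != 0 -> normc (X j x) = 1.
Hypothesis X_orth :
  forall x, x != 0 -> \sum_j X j x = (if x == 1 then p.-1%:R else 0).

Lemma conjX j x : x != 0 -> conjc (X j x) = X j x^-1.
Proof.
move=> x0; have XV : X j x * X j x^-1 = 1 by rewrite -XM mulfV.
apply: (mulfI (_ : X j x != 0)); last by rewrite XV -normc_sqr Xn // expr1n.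
by apply: contraTneq (oner_neq0 C) => e; rewrite -XV e mul0r eqxx.
Qed.

Lemma conjc_scale (x : R) (z : C) : conjc (x%:C%C * z) = x%:C%C * conjc z.
Proof.
by case: z => a b; apply/eqP; rewrite eq_complex /=; apply/andP; split; apply/eqP; ring.
Qed.

Lemma X_orthogonal x y : x != 0 -> y != 0 ->
  \sum_j X j x * X j y^-1 = (if x == y then p.-1%:R else 0).
Proof.
move=> x0 y0; under eq_bigr => j _ do rewrite -XM.
rewrite X_orth ?mulf_neq0 ?invr_eq0 //; congr (if _ then _ else _).
by rewrite -(inj_eq (mulIf y0)) divfK // mul1r.
Qed.

(** Multiplicative characters see only the nonzero elements, whence the condition at 0. *)
Lemma parseval (c : 'F_p -> R) : c 0 = 0 ->
  \sum_j normc (\sum_l (c l)%:C%C * X j l) ^+ 2 = p.-1%:R * \sum_l c l ^+ 2.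
Proof.
move=> c0; apply: complexI.
rewrite rmorph_sum rmorphM rmorph_nat rmorph_sum /= mulr_sumr.
under eq_bigr => j _ do rewrite normc_sqr mulr_suml.
rewrite exchange_big /=; apply: eq_bigr => l _.
have [->|l0] := eqVneq l 0.
  rewrite c0 expr0n mulr0 big1 // => j _.
  by rewrite -[_%:C%C]/(real_complex R 0) rmorph0 !mul0r.
under eq_bigr => j _ do rewrite rmorph_sum mulr_sumr.
rewrite exchange_big /= (bigD1 l) //= [X in _ + X]big1 => [|m ml].
  rewrite addr0.
  transitivity (\sum_j (c l ^+ 2)%:C%C * (X j l * X j l^-1)).
    apply: eq_bigr => j _; rewrite -[X in _ * X]/(conjc _) conjc_scale conjX //.
    by rewrite expr2 rmorphM; ring.
  by rewrite -mulr_sumr X_orthogonal // eqxx mulrC.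
have [m0|m0] := eqVneq m 0.
  by rewrite big1 // => j _; rewrite m0 X0 mulr0 rmorph0 mulr0.
transitivity (\sum_j (c l)%:C%C * (c m)%:C%C * (X j l * X j m^-1)).
  apply: eq_bigr => j _; rewrite -[X in _ * X]/(conjc _) conjc_scale conjX //.
  by ring.
by rewrite -mulr_sumr X_orthogonal // eq_sym (negbTE ml) mulr0.
Qed.

Let S j : C := \sum_(t < N) X j (f t).

Lemma moment_energy r :
  \sum_j normc (S j) ^+ (2 * r) = p.-1%:R * energy p R H N r.
Proof.
rewrite /energy -parseval ?fact_conv0 //; apply: eq_bigr => j _.
by rewrite (fact_conv_transform (X1 j) (@XM j)) normcX -exprM mulnC.
Qed.

Lemma count_inversion ell (a : 'F_p) : a != 0 ->
  p.-1%:R * (factorial_product_count ell H N a)%:R = \sum_j S j ^+ ell * X j a^-1.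
Proof.
move=> a0.
under eq_bigr => j _ do rewrite -(count_transform (X1 j) (@XM j)) mulr_suml.
rewrite exchange_big /= (bigD1 a) //= [X in _ + X]big1 => [|b ba].
  rewrite addr0; under eq_bigr => j _ do rewrite -mulrA.
  by rewrite -mulr_sumr X_orthogonal // eqxx mulrC.
under eq_bigr => j _ do rewrite -mulrA.
rewrite -mulr_sumr; have [->|b0] := eqVneq b 0.
  by rewrite big1 ?mulr0 // => j _; rewrite X0 mul0r.
by rewrite X_orthogonal // (negbTE ba) mulr0.
Qed.

Lemma deviation_bound ell r (M : R) (a : 'F_p) : a != 0 -> (2 * r <= ell)%N -> 0 <= M ->
    (forall (j : 'I_p.-1) x, x != 0 -> j = 0%N :> nat -> X j x = 1) ->
    (forall j : 'I_p.-1, (j != 0 :> nat)%N -> normc (S j) <= M) ->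
  `|(factorial_product_count ell H N a)%:R - N%:R ^+ ell / (p%:R - 1)|
    <= M ^+ (ell - 2 * r) * energy p R H N r.
Proof.
move=> a0 le_r M0 X_triv S_le.
have p1 : (0 < p.-1)%N by have := prime_gt1 p_pr; lia.
have pE : p%:R - 1 = p.-1%:R :> R.
  by rewrite -[in LHS](prednK (prime_gt0 p_pr)) -natr1 addrK.
have d0 : 0 < p.-1%:R :> R by rewrite ltr0n.
rewrite pE -(ler_pM2l d0) -{1}(ger0_norm (ltW d0)) -normrM.
rewrite mulrBr mulrCA mulfV ?gt_eqF // mulr1.
rewrite -normc_real rmorphB rmorphM rmorphXn !rmorph_nat count_inversion //.
(* The principal character contributes exactly N^ell, that is, the mean. *)
pose j0 := Ordinal p1.
rewrite (bigD1 j0) //= X_triv ?invr_eq0 // mulr1.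
have -> : S j0 = N%:R.
  rewrite /S (eq_bigr (fun=> 1)) => [|t _]; first by rewrite sumr_const card_ord.
  by rewrite X_triv // (shifted_fact_neq0 p_pr HN_lt).
rewrite addrAC subrr add0r.
apply: le_trans (normc_sum _ _ _) _.
rewrite [leRHS]mulrCA -moment_energy mulr_sumr.
(* The full moment on the right also contains the principal character, whose term is nonnegative. *)
rewrite [leRHS](bigD1 j0) //=.
apply: (@le_trans _ _ (\sum_(j | j != j0) M ^+ (ell - 2 * r) * normc (S j) ^+ (2 * r))).
  apply: ler_sum => j jj0; rewrite normcM Xn ?invr_eq0 // mulr1 normcX.
  rewrite -{1}(subnK le_r) exprD ler_wpM2r ?exprn_ge0 ?normc_ge0 //.
  by rewrite lerXn2r ?nnegrE ?normc_ge0 ?S_le.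
by rewrite lerDr mulr_ge0 ?exprn_ge0 ?normc_ge0.
Qed.

End Family.

Lemma factorial_product_deviation ell r (a : 'F_p) : a != 0 -> (2 * r <= ell)%N ->
  `|(factorial_product_count ell H N a)%:R - N%:R ^+ ell / (p%:R - 1)|
    <= (34 ^+ 2 * N%:R ^+ 3 * Num.sqrt p%:R) `^ 4^-1 ^+ (ell - 2 * r) * energy p R H N r.
Proof.
move=> a0 le_r.
have [X [X0 X1 XM Xn [X_orth X_sum X_triv]]] := multiplicative_characters R p_pr.
set M := _ `^ _; have M0 : 0 <= M by apply: powR_ge0.
apply: (deviation_bound X0 X1 XM Xn X_orth a0 le_r M0 X_triv) => j j0.
rewrite /M; set z := normc _.
have z0 : 0 <= z by apply: normc_ge0.
have -> : z = (z ^+ 4) `^ 4^-1.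
  by rewrite -powR_mulrn // -powRrM mulfV ?pnatr_eq0 // powRr1.
apply: ge0_ler_powR; rewrite ?nnegrE ?exprn_ge0 ?mulr_ge0 ?sqrtr_ge0 ?exprn_ge0 //.
exact: (factorial_sum_bound p_pr (X0 j) (X1 j) (@XM j) (X_sum j j0) (Xn j) HN_lt).
Qed.

End Fourier.

(** * The final exponents and constant *)

Theorem theorem8 (R : realType) (ell r : nat)
    (hr : (1 <= 2 * r)%N) (hell : (2 * r <= ell)%N) :
  exists C : R, 0 < C /\
    forall p H N : nat, prime p -> odd p -> (H < H + N)%N -> (H + N < p)%N ->
      \big[Num.max/0]_(a : 'F_p | a != 0)
        `| (factorial_product_count ell H N a)%:R
           - N%:R ^+ ell / (p%:R - 1) |
      <= C
         * N%:R `^ (3 * ell%:R / 4 + r%:R / 2 - 1 + 2 ^- r)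
         * p%:R `^ ((ell%:R - 2 * r%:R) / 8)
         * ln p%:R `^ ((ell%:R - 2 * r%:R) / 4).
Proof.
have [Ce Ce0 energy_le] := energy_bound R r.
pose D : R := (ell - 2 * r)%:R.
have DE : ell%:R - 2 * r%:R = D by rewrite /D natrB // natrM.
(* A lower bound, uniform in p, for the power of [ln p] in the statement; it is compensated by
   dividing the constant by c. *)
pose c := ln 2%:R `^ (D / 4) : R.
have ln2 : 0 < ln 2%:R :> R by rewrite ln_gt0 // ltr1n.
have c0 : 0 < c by rewrite powR_gt0.
pose b : R := (34 ^+ 2) `^ (D / 4).
have b0 : 0 < b by rewrite powR_gt0.
exists (b * Ce / c); split=> [|p H N p_pr _ HN_pos HN].
  by rewrite !mulr_gt0 ?invr_gt0.
have N0 : (0 < N)%N by lia.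
have N1 : 0 < N%:R :> R by rewrite ltr0n.
have p1 := prime_gt1 p_pr.
rewrite DE; set rhs := (X in _ <= X).
have rhs0 : 0 <= rhs by rewrite !mulr_ge0 ?powR_ge0 ?invr_ge0 // ltW.
apply: bigmax_le => // a a0.
apply: le_trans (factorial_product_deviation R p_pr HN a0 hell) _.
have -> : (34 ^+ 2 * N%:R ^+ 3 * Num.sqrt p%:R) `^ 4^-1 ^+ (ell - 2 * r)
    = b * N%:R `^ (3 * D / 4) * p%:R `^ (D / 8) :> R.
  rewrite -powR_mulrn ?powR_ge0 // -powRrM -/D [4^-1 * D]mulrC.
  rewrite -(powR_mulrn 3 (ltW N1)) -powR12_sqrt //.
  rewrite powRM ?mulr_ge0 ?exprn_ge0 ?powR_ge0 // powRM ?exprn_ge0 ?powR_ge0 //.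
  rewrite -2!powRrM; congr (_ * _ `^ _ * _ `^ _); by field.
have E_le : energy p R H N r <= Ce * N%:R `^ (2 * r%:R + 2 ^- r - 1).
  rewrite -(ler_pM2l N1); apply: le_trans (energy_le p H N p_pr N0 HN) _.
  have ND (x y : R) : N%:R `^ (x + y) = N%:R `^ x * N%:R `^ y.
    by rewrite powRD //; apply/implyP => _; rewrite gt_eqF.
  have -> : N%:R * (Ce * N%:R `^ (2 * r%:R + 2 ^- r - 1))
      = Ce * (N%:R `^ (1 + (2 * r%:R + 2 ^- r - 1))).
    by rewrite (ND 1) powRr1 // mulrCA.
  rewrite (_ : 1 + _ = (2 * r)%:R + 2 ^- r); last by rewrite natrM; ring.
  by rewrite ND powR_mulrn // mulrA.
apply: le_trans (ler_wpM2l _ E_le) _.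
  by rewrite !mulr_ge0 ?powR_ge0 // ltW.
have ln_le : c <= ln p%:R `^ (D / 4).
  apply: ge0_ler_powR; rewrite ?nnegrE ?divr_ge0 ?ler0n //; first exact: ltW.
    by rewrite ln_ge0 // ler1n ltnW.
  by rewrite ler_ln ?posrE ?ltr0n ?ler_nat // ltnW.
have -> : b * N%:R `^ (3 * D / 4) * p%:R `^ (D / 8) *
     (Ce * N%:R `^ (2 * r%:R + 2 ^- r - 1))
   = b * Ce / c * N%:R `^ (3 * ell%:R / 4 + r%:R / 2 - 1 + 2 ^- r) * p%:R `^ (D / 8) * c.
  (* With D = ell - 2 r, the character sums contribute 3 D / 4 and the energy 2 r - 1 + 2^(-r) to
     the exponent of N. *)
  have -> : 3 * ell%:R / 4 + r%:R / 2 - 1 + 2 ^- r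
      = 3 * D / 4 + (2 * r%:R + 2 ^- r - 1) :> R.
    by rewrite -DE; field.
  rewrite [in RHS]powRD; last by apply/implyP => _; rewrite gt_eqF.
  move: (N%:R `^ _) (N%:R `^ _) (p%:R `^ _) => x y z.
  by field; rewrite gt_eqF.
by rewrite ler_wpM2l // !mulr_ge0 ?powR_ge0 ?invr_ge0 ?(ltW c0) ?(ltW b0) ?(ltW Ce0).
Qed.
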